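(* Assume that the budget satisfies $$\overline\mu>\sup_{s\in[0,T]}\left(\sum_{i=1}^N h^i_\mu\,(p^i_D(s))^+\right).$$ Then, for the controlled diffusion with state $z=(s,Q,D)$, drift $b$, volatility $\sigma$, control set $U$ and constraint set $C=\mathbb{R}\times K$ described in the context, both of the following hold. (A) There exist two Lipschitz continuous mappings $\tilde u:C^\circ\to U$ and $\hat u:C\to U$ such that for all $(t,z)\in[0,T]\times C^\circ$ the solution of $\tilde X_r=z+\int_t^r b(\tilde X_\tau,\tilde u(\tilde X_\tau))\,\mathrm{d}\tau+\int_t^r\sigma(\tilde X_\tau,\tilde u(\tilde X_\tau))\,\mathrm{d}W_\tau$ stays in $C^\circ$ for all $r\in[0,T]$, $\mathbb{P}$-a.s., and for all $(t,z)\in[0,T]\times C$ the solution of $\hat X_r=z+\int_t^r b(\hat X_\tau,\hat u(\hat X_\tau))\,\mathrm{d}\tau+\int_t^r\sigma(\hat X_\tau,\hat u(\hat X_\tau))\,\mathrm{d}W_\tau$ stays in $C$ for all $r\in[0,T]$, $\mathbb{P}$-a.s. (B) For each $x\in\partial C$ there exist $u_x\in U$, $r>0$ and $\eta>0$ such that $\sigma(z,u_x)=0$ for all $z\in B(x,\eta)\cap C$, and $B(z+t\,b(z,u_x),rt)\subseteq C^\circ$ for all $z\in B(x,\eta)\cap C$ and all $t\in(0,r)$.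
   Context: Network. There are nodes $\{1,\dots,N\}$ and a finite set of edges $E=\{e_1,\dots,e_M\}$, $N,M\ge 1$; each edge connects two nodes. $K_i$ is the set of edges connected to node $i$; for $e\in K_i$, $sgn(e,i)\in\{+1,-1\}$ encodes an arbitrarily fixed direction of $e$. Each edge has resistance $r^e\ge0$ and flow limits $\underline\phi^e\le\overline\phi^e$. For $(Q,D)\in\mathbb{R}^N_+\times\mathbb{R}^N_+$, $$G(Q,D)=\max_{(q,\phi)\in[0,Q]\times[\underline\phi,\overline\phi]}\ \min_{i=1,\dots,N}\ q^i-D^i+\sum_{e\in K_i}\Big(sgn(e,i)\phi^e-\tfrac{r^e}{2}(\phi^e)^2\Big)$$ (intervals componentwise), and $K=G^{-1}(\mathbb{R}_+)$. Dynamics. $W=(W^1,\dots,W^N)$ is an $N$-dimensional Brownian motion and $T>0$. The control set is $U=U_{\bar\mu}\times[0,1]^N$ with $U_{\bar\mu}=\{\mu\in\mathbb{R}^N_+:\sum_{i=1}^N h^i_\mu\mu^i\le\bar\mu\}$, where $\bar\mu>0$ and $h^i_\mu\in(0,\infty)$. For a control $\nu=(\mu,\alpha)$, capacity and demand follow $$Q^i_r=x_Q^i+\int_t^r\mu^i_\tau\,\mathrm{d}\tau+\int_t^r\sigma^i(Q^i_\tau-\hat Q^i)(1-\alpha^i_\tau)\,\mathrm{d}W^i_\tau,\qquad D^i_r=x_D^i+\int_t^r p^i_D(\tau)\,\mathrm{d}\tau,$$ where $\sigma^i\ge0$, $\hat Q\in\mathbb{R}^N_+$ and $p_D:\mathbb{R}_+\to\mathbb{R}^N$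 is bounded and Lipschitz continuous. Since the demand drift depends on time, time is included as a state variable: the state is $z=(s,Q,D)\in\mathbb{R}\times\mathbb{R}^N\times\mathbb{R}^N$, and for $u=(\mu,\alpha)\in U$ the drift is $b(z,u)=(1,\mu,p_D(s))$ and the volatility $\sigma(z,u)$ is the $(1+2N)\times N$ matrix whose only possibly nonzero entries are $\sigma^i(Q^i-\hat Q^i)(1-\alpha^i)$ in the row of $Q^i$ and column $i$. For $s\notin[0,T]$, $p_D(s)$ is replaced by its value at the nearest point of $[0,T]$. States are kept equal to their initial value before time $t$. $B(x,\gamma)$ denotes the Euclidean ball, $C^\circ$ and $\partial C$ interior and boundary, $a^+=\max(a,0)$.
   Formalization: In the definition of K, the demand D ranges over all of R^N (only Q ≥ 0 and G(Q,D) ≥ 0 are required) instead of R_+^N, since the uncontrolled demand may become negative when p_D is negative, making the claim false with D ≥ 0. *)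

(* Defs.v *)
From HB Require Import structures.
From mathcomp Require Import all_boot all_order all_algebra.
From mathcomp Require Import all_classical all_reals all_analysis.

Set Implicit Arguments.
Unset Strict Implicit.
Unset Printing Implicit Defensive.

Import Order.TTheory GRing.Theory Num.Theory.
Import numFieldNormedType.Exports.

#[global] Open Scope classical_set_scope.
#[global] Open Scope ring_scope.

(** * Euclidean geometry

    The library norm on ['cV[R]_n] is the sup norm.  It is equivalent to the
    Euclidean norm, so interiors, closures and the property of being Lipschitz
    are the usual ones; balls are not, hence the definitions below. *)

Definition enorm (R : realType) (n : nat) (x : 'cV[R]_n) : R :=
  Num.sqrt (\sum_i x i 0 ^+ 2).

Definition eball (R : realType) (n : nat) (x : 'cV[R]_n) (g : R) :
    set 'cV[R]_n :=
  [set y | enorm (y - x) < g].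

Definition boundary (T : topologicalType) (C : set T) : set T :=
  closure C `\` C°.

(** * The network *)

Record network (R : realType) (N M : nat) := Network {
  edge_tail : 'I_M -> 'I_N;
  edge_head : 'I_M -> 'I_N;
  resistance : 'I_M -> R;
  flow_min : 'I_M -> R;
  flow_max : 'I_M -> R;
  edge_tail_neq_head : forall e, edge_tail e != edge_head e;
  resistance_ge0 : forall e, 0 <= resistance e;
  flow_min_le_max : forall e, flow_min e <= flow_max e
}.

Definition incident R N M (nw : network R N M) (i : 'I_N) : {set 'I_M} :=
  [set e | (edge_tail nw e == i) || (edge_head nw e == i)]%SET.

(* Only meaningful for e in [incident nw i]; the choice of direction is the
   choice of [edge_tail] and [edge_head]. *)
Definition sgn R N M (nw : network R N M) (e : 'I_M) (i : 'I_N) : R :=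
  if edge_head nw e == i then 1 else -1.

Definition balance R N M (nw : network R N M) (D q : 'cV[R]_N) (phi : 'cV[R]_M)
    (i : 'I_N) : R :=
  q i 0 - D i 0 +
  \sum_(e in incident nw i)
     (sgn nw e i * phi e 0 - resistance nw e / 2 * phi e 0 ^+ 2).

Definition feasible R N M (nw : network R N M) (Q : 'cV[R]_N) :
    set ('cV[R]_N * 'cV[R]_M) :=
  [set x : 'cV[R]_N * 'cV[R]_M | (forall i, 0 <= x.1 i 0 <= Q i 0) /\
           (forall e, flow_min nw e <= x.2 e 0 <= flow_max nw e)].

(* For 0 < N and Q >= 0 the infimum is over a finite nonempty set and the
   supremum is that of a continuous function over a nonempty compact set: they
   are the min and the max.  The formula makes sense for every real D. *)
Definition Gfun R N M (nw : network R N M) (Q D : 'cV[R]_N) : R :=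
  sup [set inf (range (balance nw D x.1 x.2)) | x in feasible nw Q].

(* Q >= 0 has to be required: otherwise [feasible nw Q] is empty and the
   supremum takes the default value 0.  The components of D range over R: p_D
   may be negative or zero, so that D >= 0 is not preserved by the uncontrolled
   demand D' = p_D(s), and cannot be part of a constraint set that is to be
   invariant. *)
Definition Kset R N M (nw : network R N M) : set ('cV[R]_N * 'cV[R]_N) :=
  [set x : 'cV[R]_N * 'cV[R]_N | (forall i, 0 <= x.1 i 0) /\ 0 <= Gfun nw x.1 x.2].

(** * Controlled capacity and demand *)

Record model (R : realType) (N : nat) := Model {
  horizon : R;
  unit_cost : 'cV[R]_N;             (* h_mu *)
  budget : R;                       (* \bar\mu *)
  vol : 'cV[R]_N;                   (* sigma^i *)
  Qhat : 'cV[R]_N;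
  demand_drift : R -> 'cV[R]_N;     (* p_D, relevant on [0, +oo[ only *)
  horizon_gt0 : 0 < horizon;
  unit_cost_gt0 : forall i, 0 < unit_cost i 0;
  budget_gt0 : 0 < budget;
  vol_ge0 : forall i, 0 <= vol i 0;
  Qhat_ge0 : forall i, 0 <= Qhat i 0;
  demand_drift_bounded : [bounded demand_drift s | s in `[0, +oo[ ];
  demand_drift_lipschitz : [lipschitz demand_drift s | s in `[0, +oo[ ]
}.

Notation state R N := ('cV[R]_(1 + (N + N))).
Notation control R N := ('cV[R]_N * 'cV[R]_N)%type.

Definition stT (R : realType) N (z : state R N) : R := usubmx z 0 0.
Definition stQ (R : realType) N (z : state R N) : 'cV[R]_N := usubmx (dsubmx z).
Definition stD (R : realType) N (z : state R N) : 'cV[R]_N := dsubmx (dsubmx z).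

Definition Uset R N (md : model R N) : set (control R N) :=
  [set u : control R N | [/\ forall i, 0 <= u.1 i 0,
               \sum_i unit_cost md i 0 * u.1 i 0 <= budget md &
               forall i, 0 <= u.2 i 0 <= 1]].

(* The value of p_D at the point of [0, T] nearest to s. *)
Definition clamped_drift R N (md : model R N) (s : R) : 'cV[R]_N :=
  demand_drift md (Num.max 0 (Num.min s (horizon md))).

Definition drift R N (md : model R N) (z : state R N) (u : control R N) :
    state R N :=
  col_mx (const_mx 1) (col_mx u.1 (clamped_drift md (stT z))).

Definition volatility R N (md : model R N) (z : state R N) (u : control R N) :
    'M[R]_(1 + (N + N), N) :=
  col_mx (0 : 'M[R]_(1, N))
    (col_mx (diag_mx (\row_i (vol md i 0 * (stQ z i 0 - Qhat md i 0)
                              * (1 - u.2 i 0))))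
            (0 : 'M[R]_(N, N))).

Definition constraint_set R N M (nw : network R N M) : set (state R N) :=
  [set z | Kset nw (stQ z, stD z)].

(** * Brownian motion *)

Definition filtration d (Omega : measurableType d) (R : realType)
    (F : R -> set (set Omega)) : Prop :=
  [/\ forall t, 0 <= t -> sigma_algebra setT (F t),
      forall t, 0 <= t -> F t `<=` measurable &
      forall s t, 0 <= s -> s <= t -> F s `<=` F t].

Definition measurable_wrt d (Omega : measurableType d) (R : realType)
    (S : set (set Omega)) (f : Omega -> R) : Prop :=
  forall B : set R, measurable B -> S (f @^-1` B).

Definition adapted d (Omega : measurableType d) (R : realType) n
    (F : R -> set (set Omega)) (J : set R) (X : R -> Omega -> 'cV[R]_n) :
    Prop :=
  forall t, J t -> forall i, measurable_wrt (F t) (fun w => X t w i 0).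

(* The third clause says, on the pi-system of rectangles, that W_t - W_s is
   independent of F_s with law N(0, (t - s) I_N). *)
Definition brownian_motion d (Omega : measurableType d) (R : realType)
    (P : probability Omega R) N (F : R -> set (set Omega))
    (W : R -> Omega -> 'cV[R]_N) : Prop :=
  [/\ adapted F `[0, +oo[ W,
      {ae P, forall w, W 0 w = 0},
      forall s t, 0 <= s -> s < t ->
        forall A, F s A ->
        forall B : 'I_N -> set R, (forall i, measurable (B i)) ->
          P (A `&` [set w | forall i, B i (W t w i 0 - W s w i 0)]) =
          (P A * \big[*%E/1]_(i < N) normal_prob 0 (Num.sqrt (t - s)) (B i))%E &
      {ae P, forall w, {within `[0, +oo[, continuous (W ^~ w)}}].

(** * Ito integral *)

Record simple_process d (Omega : measurableType d) (R : realType)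
    (F : R -> set (set Omega)) (t : R) := SimpleProcess {
  sp_size : nat;
  sp_grid : nat -> R;
  sp_val : nat -> Omega -> R;
  sp_start : t <= sp_grid 0;
  sp_grid_homo : {homo sp_grid : m n / (m <= n)%N >-> m <= n};
  sp_measurable : forall j, measurable_wrt (F (sp_grid j)) (sp_val j);
  sp_bounded : exists c, forall j w, `|sp_val j w| <= c
}.

Definition sp_fun d (Omega : measurableType d) (R : realType)
    (F : R -> set (set Omega)) (t : R) (H : simple_process F t)
    (s : R) (w : Omega) : R :=
  \sum_(j < sp_size H)
     sp_val H j w * \1_(`]sp_grid H j, sp_grid H j.+1]) s.

Definition sp_integral d (Omega : measurableType d) (R : realType)
    (F : R -> set (set Omega)) (t : R) (H : simple_process F t)
    (B : R -> Omega -> R) (r : R) (w : Omega) : R :=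
  \sum_(j < sp_size H)
     sp_val H j w *
     (B (Num.min (sp_grid H j.+1) r) w - B (Num.min (sp_grid H j) r) w).

(* Convergence to 0 in probability of nonnegative quantities.  The outer
   measure [P^*] agrees with P on measurable sets. *)
Definition cvg0_prob d (Omega : measurableType d) (R : realType)
    (P : probability Omega R) (Y : nat -> Omega -> \bar R) : Prop :=
  forall e : R, 0 < e ->
    (P^*)%mu [set w | (e%:E <= Y n w)%E] @[n --> \oo] --> 0%E.

(* I is (the continuous version of) r |-> \int_t^r H dB on [t, T], for one
   Brownian component B and an integrand H that is approximated by simple
   processes in L^2(dt) in probability; the integral is the limit in
   probability of the elementary integrals. *)
Definition is_ito_integral d (Omega : measurableType d) (R : realType)
    (P : probability Omega R) (F : R -> set (set Omega)) (B : R -> Omega -> R)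
    (t T : R) (H I : R -> Omega -> R) : Prop :=
  [/\ {ae P, forall w, measurable_fun `[t, T] (H ^~ w)},
      {ae P, forall w, {within `[t, T], continuous (I ^~ w)}} &
      exists Hn : nat -> simple_process F t,
        cvg0_prob P (fun n w =>
          \int[lebesgue_measure]_(s in `[t, T])
             ((sp_fun (Hn n) s w - H s w) ^+ 2)%:E)%E /\
        forall r, r \in `[t, T] ->
          cvg0_prob P (fun n w =>
            `|sp_integral (Hn n) B r w - I r w|%:E)].

(** * Stochastic differential equations with feedback control *)

Definition is_solution d (Omega : measurableType d) (R : realType)
    (P : probability Omega R) n N (C : Type) (F : R -> set (set Omega))
    (W : R -> Omega -> 'cV[R]_N)
    (b : 'cV[R]_n -> C -> 'cV[R]_n) (sigma : 'cV[R]_n -> C -> 'M[R]_(n, N))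
    (u : 'cV[R]_n -> C) (T t : R) (z : 'cV[R]_n) (X : R -> Omega -> 'cV[R]_n) :
    Prop :=
  [/\ adapted F `[0, T] X,
      {ae P, forall w, {within `[0, T], continuous (X ^~ w)}},
      forall r w, r \in `[0, t] -> X r w = z,
      {ae P, forall w, forall j, lebesgue_measure.-integrable `[t, T]
         (fun s => (b (X s w) (u (X s w)) j 0)%:E)} &
      exists I : 'I_n -> 'I_N -> R -> Omega -> R,
        (forall j i, is_ito_integral P F (fun s w => W s w i 0) t T
           (fun s w => sigma (X s w) (u (X s w)) j i) (I j i)) /\
        {ae P, forall w, forall r, r \in `[t, T] -> forall j,
           X r w j 0 =
           z j 0
           + \int[lebesgue_measure]_(s in `[t, r]) b (X s w) (u (X s w)) j 0
           + \sum_i I j i r w}].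

Definition stays_in d (Omega : measurableType d) (R : realType)
    (P : probability Omega R) n (T : R) (A : set 'cV[R]_n)
    (X : R -> Omega -> 'cV[R]_n) : Prop :=
  {ae P, forall w, forall r, r \in `[0, T] -> A (X r w)}.

(* "The solution stays in A", for a feedback u that is defined on A only (its
   values off A are junk): there is a solution with values in A on the whole
   of [0, T], and it is unique up to indistinguishability. *)
Definition the_solution_stays_in d (Omega : measurableType d) (R : realType)
    (P : probability Omega R) n N (C : Type) (F : R -> set (set Omega))
    (W : R -> Omega -> 'cV[R]_N)
    (b : 'cV[R]_n -> C -> 'cV[R]_n) (sigma : 'cV[R]_n -> C -> 'M[R]_(n, N))
    (u : 'cV[R]_n -> C) (T t : R) (z : 'cV[R]_n) (A : set 'cV[R]_n) : Prop :=
  exists X, [/\ is_solution P F W b sigma u T t z X,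
                stays_in P T A X &
                forall Y, is_solution P F W b sigma u T t z Y ->
                  stays_in P T A Y ->
                  {ae P, forall w, forall r, r \in `[0, T] ->
                     Y r w = X r w}].

(* Main.v *)
Require Import Defs.
From HB Require Import structures.
From mathcomp Require Import all_boot all_order all_algebra.
From mathcomp Require Import all_classical all_reals all_analysis.
From mathcomp Require Import measurable_realfun ring lra.

(** With [alpha = 1] the noise is switched off, and with [mu = (p_D)^+] capacity
    grows at least as fast as demand.  Along such a deterministic path the
    balance at every node can be kept from decreasing, by adding to [q] whatever
    is added to [Q]; so G does not decrease, and neither K nor its interior is
    left.  This one feedback serves as both [utilde] and [uhat].  For (B), the
    slack in the budget allows [mu = (p_D)^+ + e] with [e > 0], which pushes
    strictly inwards.

    Uniqueness requires every Ito integral of the zero integrand to vanish: if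
    the energies of simple processes tend to 0 in probability, so must their
    elementary integrals.  Stopping a simple process as soon as its energy
    exceeds [c] makes the second moment of its integral at most [16 * c], whence
    [P(|int H dB| >= e) <= P(energy >= c) + 16 c / e^2]. *)

Import Order.TTheory GRing.Theory Num.Theory.
Import numFieldNormedType.Exports.

Set Implicit Arguments.
Unset Strict Implicit.
Unset Printing Implicit Defensive.

Local Open Scope classical_set_scope.
Local Open Scope ring_scope.

(** * Second moments of the normal law *)

(** Reflection swaps the two half-lines, and the substitution rule applies to each of them; the
    point 0 is null, so it may belong to both. *)
Lemma ge0_integral_lebesgue_oppr (R : realType) (f : R -> \bar R) :
  measurable_fun [set: R] f -> (forall x, 0 <= f x)%E ->
  (\int[lebesgue_measure]_x f (- x)%R = \int[lebesgue_measure]_x f x)%E.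
Proof.
have split0 (g : R -> \bar R) : measurable_fun [set: R] g -> (forall x, 0 <= g x)%E ->
    (\int[lebesgue_measure]_x g x = \int[lebesgue_measure]_(x in `]-oo, 0%R]) g x +
      \int[lebesgue_measure]_(x in `[0%R, +oo[) g x)%E.
  move=> mg g0; rewrite -(integral_itv_obnd_cbnd (r := 0))//; last first.
    exact: measurable_funTS.
  rewrite -ge0_integral_setU//=; last 2 first.
  - exact: measurable_funTS.
  - by apply/disj_setPRL => x /=; rewrite !in_itv/= andbT => x0; apply/negP; rewrite -ltNge.
  by rewrite -(itv_setU_setT false (0 : R)).
move=> mf f0.
have mfN : measurable_fun [set: R] (fun x => f (- x)).
  by apply: (measurableT_comp (f := f)) => //.
rewrite !split0// -ge0_integration_by_substitution0// addeC; congr (_ + _)%E.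
by rewrite ge0_integration_by_substitution0//; under eq_integral do rewrite opprK.
Qed.

(** The Radon-Nikodym derivative and [normal_pdf] have the same integral over every measurable set,
    hence agree almost everywhere. *)
Lemma ge0_integral_normal_prob (R : realType) (m s : R) (f : R -> \bar R) :
  measurable_fun [set: R] f -> (forall x, 0 <= f x)%E ->
  (\int[normal_prob m s]_x f x =
   \int[lebesgue_measure]_x (f x * (normal_pdf m s x)%:E))%E.
Proof.
move=> mf f0; have dom := normal_prob_dominates m s.
rewrite -(Radon_Nikodym_SigmaFinite.change_of_variables dom)//.
have mRN := measurable_int _ (Radon_Nikodym_SigmaFinite.f_integrable dom).
have mpdf := measurable_int _ (integrable_normal_pdf m s).
apply: ae_eq_integral => //; [exact: emeasurable_funM..|].
apply: ae_eqe_mul2l; apply: integral_ae_eq => //.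
  exact: Radon_Nikodym_SigmaFinite.f_integrable.
by move=> E _ mE; rewrite -Radon_Nikodym_SigmaFinite.f_integral.
Qed.

Lemma ge0_integral_normal_prob_oppr (R : realType) (s : R) (f : R -> \bar R) : s != 0 ->
  measurable_fun [set: R] f -> (forall x, 0 <= f x)%E ->
  (\int[normal_prob 0 s]_x f (- x)%R = \int[normal_prob 0 s]_x f x)%E.
Proof.
move=> s0 mf f0.
have mfN : measurable_fun [set: R] (fun x => f (- x)).
  by apply: (measurableT_comp (f := f)) => //.
rewrite !ge0_integral_normal_prob// -[RHS]ge0_integral_lebesgue_oppr.
- apply: eq_integral => x _; congr (_ * _%:E)%E.
  by rewrite !normal_pdfE// /normal_fun !subr0 sqrrN.
- apply: emeasurable_funM => //; exact: measurable_int _ (integrable_normal_pdf 0 s).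
- by move=> x; rewrite mule_ge0// lee_fin normal_pdf_ge0.
Qed.

(* Doubling the standard deviation absorbs the factor [y ^+ 2], since [u <= expR (3 * u)]. *)
Lemma normal_sqr_pdf_le (R : realType) (s y : R) : 0 < s ->
  y ^+ 2 * normal_pdf 0 s y <= 16 * s ^+ 2 * normal_pdf 0 (2 * s) y.
Proof.
move=> s0; have s20 : 0 < 2 * s by rewrite mulr_gt0.
rewrite !normal_pdfE ?gt_eqF//.
have -> : normal_peak s = 2 * normal_peak (2 * s).
  rewrite /normal_peak (_ : (2 * s) ^+ 2 * pi *+ 2 = 2 ^+ 2 * (s ^+ 2 * pi *+ 2)); last by ring.
  rewrite sqrtrM ?sqr_ge0// sqrtr_sqr ger0_norm// invfM.
  by rewrite mulrA divff// mul1r.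
rewrite /normal_fun !subr0 !mulNr.
(* In terms of [u] the exponents are [- 4 * u] for deviation [s] and [- u] for deviation [2 * s].
   After cancelling [16 * s ^+ 2] and the peak, the claim is
   [u * expR (- (4 * u)) <= expR (- u)]. *)
set u := y ^+ 2 / ((2 * s) ^+ 2 *+ 2).
have -> : y ^+ 2 / (s ^+ 2 *+ 2) = 4 * u by rewrite /u; field; rewrite gt_eqF.
have -> : y ^+ 2 = 8 * s ^+ 2 * u by rewrite /u; field; rewrite gt_eqF.
have u0 : 0 <= u by rewrite /u divr_ge0 ?sqr_ge0// mulrn_wge0// sqr_ge0.
rewrite [leLHS](_ : _ = 16 * s ^+ 2 * (normal_peak (2 * s) * (u * expR (- (4 * u))))); last by ring.
rewrite ler_wpM2l//; first by rewrite mulr_ge0// sqr_ge0.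
rewrite ler_wpM2l ?normal_peak_ge0//.
rewrite (le_trans (y := expR (3 * u) * expR (- (4 * u))))//.
  rewrite ler_wpM2r ?expR_ge0//; apply: (le_trans _ (expR_ge1Dx _)); lra.
by rewrite -expRD ler_expR; lra.
Qed.

(* Symmetry kills the cross term without any integrability side condition:
   averaging over [y] and [- y] keeps all integrands nonnegative.  The crude
   constant 16 replaces the exact variance. *)
Lemma integral_normal_prob_sqr_le (R : realType) (s x h : R) : 0 < s ->
  (\int[normal_prob 0%R s]_y ((x + h * y) ^+ 2)%:E <=
   (x ^+ 2 + 16 * s ^+ 2 * h ^+ 2)%:E)%E.
Proof.
move=> s0; have sN0 : s != 0 by rewrite gt_eqF.
have mlin (c : R) : measurable_fun [set: R] (fun y : R => ((x + c * y) ^+ 2)%:E).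
  by apply/measurable_EFinP/measurable_funX/measurable_funD.
have msq : measurable_fun [set: R] (fun y : R => (y ^+ 2)%:E).
  by apply/measurable_EFinP/measurable_funX.
have sq_ge0 (u : R) : (0 <= (u ^+ 2)%:E)%E by rewrite lee_fin sqr_ge0.
have m2 : (\int[normal_prob 0%R s]_y (y ^+ 2)%:E <= (16 * s ^+ 2)%:E)%E.
  rewrite ge0_integral_normal_prob//.
  apply: (@le_trans _ _ (\int[lebesgue_measure]_y
      ((16 * s ^+ 2)%:E * (normal_pdf 0%R (2 * s)%R y)%:E))%E).
    apply: ge0_le_integral => //.
    - by move=> y _; rewrite mule_ge0// lee_fin normal_pdf_ge0.
    - by apply: emeasurable_funM => //; exact: measurable_int _ (integrable_normal_pdf 0 s).
    - by apply: emeasurable_funM => //; exact: measurable_int _ (integrable_normal_pdf 0 (2 * s)).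
    - by move=> y _; rewrite -!EFinM lee_fin normal_sqr_pdf_le.
  rewrite integralZl//; last exact: integrable_normal_pdf.
  by rewrite integral_normal_pdf mule1.
have dbl : (2%:E * \int[normal_prob 0%R s]_y ((x + h * y) ^+ 2)%:E =
    2%:E * \int[normal_prob 0%R s]_y ((x ^+ 2)%:E + (h ^+ 2)%:E * (y ^+ 2)%:E))%E.
  have mquad : measurable_fun [set: R]
      (fun y => (x ^+ 2)%:E + (h ^+ 2)%:E * (y ^+ 2)%:E)%E.
    by apply: emeasurable_funD => //; exact: emeasurable_funM.
  rewrite -[RHS]ge0_integralZl//; last by move=> y _; rewrite adde_ge0// mule_ge0.
  rewrite mule_natl mule2n.
  rewrite -[X in (_ + X)%E]ge0_integral_normal_prob_oppr//.
  have mopp : measurable_fun [set: R] (fun y => ((x + h * - y) ^+ 2)%:E).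
    by apply: (measurableT_comp (f := fun y => ((x + h * y) ^+ 2)%:E)).
  rewrite -ge0_integralD//; last exact: mlin.
  by apply: eq_integral => y _; rewrite -!EFinM -!EFinD; congr EFin; ring.
have : (\int[normal_prob 0%R s]_y ((x + h * y) ^+ 2)%:E <=
    \int[normal_prob 0%R s]_y ((x ^+ 2)%:E + (h ^+ 2)%:E * (y ^+ 2)%:E))%E.
  by rewrite -(@lee_pmul2l _ 2%:E)// dbl.
move=> /le_trans; apply.
rewrite ge0_integralD//; last 2 first.
- by move=> y _; rewrite mule_ge0.
- exact: emeasurable_funM.
rewrite integral_cst// [X in (_ * X)%E](_ : _ = 1%E); last exact: probability_setT.
rewrite mule1 EFinD leeD2l// ge0_integralZl// mulrC [X in (_ <= X)%E]EFinM.
exact: lee_wpmul2l.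
Qed.

(** * Independence and second moments *)

(** Gives access to the closure properties of measurable functions for a sigma-algebra that is a
    mere family of sets, such as [F s]. *)
Lemma measurable_wrtP d (Omega : measurableType d) (R : realType)
    (G : set (set Omega)) (f : Omega -> R) : sigma_algebra setT G ->
  measurable_wrt G f <->
  measurable_fun [set: g_sigma_algebraType G] (f : g_sigma_algebraType G -> R).
Proof.
move=> sG; split=> [mf _ B mB|mf B mB].
  by rewrite setTI; apply: sub_sigma_algebra; exact: mf.
by have := mf measurableT B mB; rewrite setTI /measurable/= sigma_algebra_id.
Qed.

Lemma measurable_wrt_measurable d (Omega : measurableType d) (R : realType)
    (G : set (set Omega)) (f : Omega -> R) : G `<=` measurable ->
  measurable_wrt G f -> measurable_fun [set: Omega] f.
Proof. by move=> GT mf _ B mB; rewrite setTI; exact/GT/mf. Qed.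

(** Since [X] is independent of [G], the expectation is a double integral by Tonelli. In the inner
    integral [S w] and [H w] are constants, and the one-dimensional moment bound applies. *)
Lemma integral_sqr_addM_indep d (Omega : measurableType d) (R : realType)
    (P : probability Omega R) (G : set (set Omega)) (X S H : Omega -> R) (s : R) :
  sigma_algebra setT G -> G `<=` measurable -> 0 < s ->
  measurable_fun [set: Omega] X ->
  (forall A B, G A -> measurable B ->
     P (A `&` X @^-1` B) = (P A * normal_prob 0%R s B)%E) ->
  measurable_wrt G S -> measurable_wrt G H ->
  (\int[P]_w ((S w + H w * X w) ^+ 2)%:E <=
   \int[P]_w (S w ^+ 2 + 16 * s ^+ 2 * H w ^+ 2)%:E)%E.
Proof.
move=> sG GT s0 mX indep GS GH.
(* [T1] is [Omega] with the smaller sigma-algebra [G]; the image of [P] under the identity into it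
   is the restriction of [P] to [G]. *)
pose T1 := g_sigma_algebraType G.
have mS : measurable_fun [set: T1] (S : T1 -> R) by apply/measurable_wrtP.
have mH : measurable_fun [set: T1] (H : T1 -> R) by apply/measurable_wrtP.
have mid : measurable_fun [set: Omega] (fun w => w : T1).
  move=> _ B; rewrite /measurable/= sigma_algebra_id// => GB.
  by rewrite setTI; exact: GT.
pose idG : {mfun Omega >-> T1} := HB.pack (fun w => w : T1) (isMeasurableFun.Build _ _ _ _ _ mid).
have mphi : measurable_fun [set: Omega] (fun w => (w : T1, X w : measurableTypeR R)).
  exact: measurable_fun_pair.
pose phi : {mfun Omega >-> (T1 * measurableTypeR R)%type} :=
  HB.pack (fun w => (w : T1, X w : measurableTypeR R)) (isMeasurableFun.Build _ _ _ _ _ mphi).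
pose f (z : T1 * measurableTypeR R) : \bar R := ((S z.1 + H z.1 * z.2) ^+ 2)%:E.
have f0 z : (0 <= f z)%E by rewrite lee_fin sqr_ge0.
have mf : measurable_fun [set: T1 * measurableTypeR R] f.
  apply/measurable_EFinP/measurable_funX/measurable_funD.
    exact: (measurableT_comp mS).
  by apply: measurable_funM => //; exact: (measurableT_comp mH).
(* Independence is agreement of the joint law with the product on rectangles, and that determines
   the product measure. *)
have law Z : measurable Z ->
    (distribution P idG \x normal_prob 0%R s)%E Z = distribution P phi Z.
  apply: (@product_measure_unique _ _ T1 (measurableTypeR R) R
    (distribution P idG) (normal_prob 0%R s) (distribution P phi)) => A B mA mB.
  by apply: indep => //; move: mA; rewrite /measurable/= sigma_algebra_id.
rewrite -[leLHS](ge0_integral_distribution phi mf f0).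
rewrite (@eq_measure_integral _ _ _ _ (distribution P idG \x normal_prob 0%R s)%E); last first.
  by move=> A mA _; exact/esym/law.
rewrite fubini_tonelli1//.
pose g (w : T1) : \bar R := (S w ^+ 2 + 16 * s ^+ 2 * H w ^+ 2)%:E.
have g0 w : (0 <= g w)%E.
  by rewrite lee_fin addr_ge0 ?sqr_ge0 // -mulrA mulr_ge0 // mulr_ge0 ?sqr_ge0.
have mg : measurable_fun [set: T1] g.
  apply/measurable_EFinP/measurable_funD; first exact: measurable_funX.
  by apply: measurable_funM => //; exact: measurable_funX.
rewrite -[leRHS](ge0_integral_distribution idG mg g0).
apply: ge0_le_integral => //.
- by move=> w _; apply: integral_ge0 => y _.
- exact: measurable_fun_fubini_tonelli_F.
- move=> w _; apply: (le_trans _ (integral_normal_prob_sqr_le (S w) (H w) s0)).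
  by rewrite /fubini_F.
Qed.

(** * Elementary stochastic integrals *)

(** The induction also carries the bound by the full sum: when the test passes at the last index,
    the full sum is at most [c]; when it fails, nothing is added. *)
Lemma truncated_sum_le (R : realType) (a : nat -> R) (c : R) (n : nat) :
  0 <= c -> (forall j, 0 <= a j) ->
  \sum_(j < n) (if \sum_(k < j.+1) a k <= c then a j else 0) <= c.
Proof.
move=> c0 a0.
suff /andP[] : (\sum_(j < n) (if \sum_(k < j.+1) a k <= c then a j else 0) <= c) &&
  (\sum_(j < n) (if \sum_(k < j.+1) a k <= c then a j else 0) <= \sum_(j < n) a j) by [].
elim: n => [|n /andP[IHc IHa]]; first by rewrite !big_ord0 c0 lexx.
rewrite big_ord_recr /=; case: ifPn => h.
  by rewrite big_ord_recr /= lerD2r IHa andbT (le_trans _ h)// big_ord_recr/= lerD2r.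
by rewrite addr0 IHc (le_trans IHa)// big_ord_recr/= lerDl.
Qed.

(** Meant for indicators of disjoint intervals, at one point: the cross terms vanish. *)
Lemma sqr_sum_exclusive (R : realType) (n : nat) (v e : 'I_n -> R) :
  (forall j, e j ^+ 2 = e j) -> (forall i j, i != j -> e i * e j = 0) ->
  (\sum_j v j * e j) ^+ 2 = \sum_j v j ^+ 2 * e j.
Proof.
move=> ee eij; rewrite expr2 big_distrlr /=; apply: eq_bigr => i _.
rewrite (bigD1 i)//= big1 ?addr0; first by rewrite -[in RHS]ee; ring.
by move=> j ji; rewrite mulrACA eij ?mulr0// eq_sym.
Qed.

Section truncated_martingale.
Context d (Omega : measurableType d) (R : realType) (P : probability Omega R).
Variables (F : R -> set (set Omega)) (B : R -> Omega -> R).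
Hypothesis hF : filtration F.
Hypothesis B_adapted : forall t, 0 <= t -> measurable_wrt (F t) (B t).
Hypothesis B_indep : forall s t, 0 <= s -> s < t -> forall A X, F s A -> measurable X ->
  P (A `&` (fun w => B t w - B s w) @^-1` X) =
  (P A * normal_prob 0%R (Num.sqrt (t - s)) X)%E.
Variables (t r : R) (t0 : 0 <= t) (tr : t <= r) (H : simple_process F t) (c : R).

(** The grid is clipped at [r], as in [sp_integral H B r]; [a j] is the energy that step [j]
    contributes up to time [r]. *)
Let g j := Num.min (sp_grid H j) r.
Let a j w := sp_val H j w ^+ 2 * (g j.+1 - g j).
(* The value stopped by the energy: the test involves [H] only up to index [j],
   so [V j] is still known at time [sp_grid H j]. *)
Let V j w := if \sum_(k < j.+1) a k w <= c then sp_val H j w else 0.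
Let S n w := \sum_(j < n) V j w * (B (g j.+1) w - B (g j) w).

Let sp_grid_le i j : (i <= j)%N -> sp_grid H i <= sp_grid H j.
Proof. exact: sp_grid_homo. Qed.

Let grid_ge j : t <= sp_grid H j.
Proof. exact: (le_trans (sp_start H)) (sp_grid_le (leq0n j)). Qed.

Let g_ge j : t <= g j. Proof. by rewrite le_min grid_ge. Qed.

Let g_le i j : (i <= j)%N -> g i <= g j.
Proof. by move=> ij; rewrite le_min ge_min sp_grid_le//= ge_min lexx orbT. Qed.

Let dg_ge0 j : 0 <= g j.+1 - g j. Proof. by rewrite subr_ge0 g_le. Qed.

Let a_ge0 j w : 0 <= a j w. Proof. by rewrite mulr_ge0 ?sqr_ge0. Qed.

Let sF s : 0 <= s -> sigma_algebra setT (F s). Proof. by case: hF => + _ _; exact. Qed.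

Let F_homo s s' : 0 <= s -> s <= s' -> F s `<=` F s'.
Proof. by case: hF => _ _; exact. Qed.

Let mW s f : 0 <= s -> measurable_wrt (F s) f <->
  measurable_fun [set: g_sigma_algebraType (F s)] (f : g_sigma_algebraType (F s) -> R).
Proof. by move=> s0; exact: measurable_wrtP (sF s0). Qed.

Let mval n j : (j <= n)%N -> measurable_fun
  [set: g_sigma_algebraType (F (sp_grid H n))]
  (sp_val H j : g_sigma_algebraType (F (sp_grid H n)) -> R).
Proof.
move=> jn; apply/mW; first exact: le_trans (grid_ge n).
move=> X mX; apply: (F_homo (le_trans t0 (grid_ge j)) (sp_grid_le jn)).
exact: sp_measurable.
Qed.

Let mB n j : (j <= n)%N -> measurable_fun
  [set: g_sigma_algebraType (F (sp_grid H n))]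
  (B (g j) : g_sigma_algebraType (F (sp_grid H n)) -> R).
Proof.
move=> jn; apply/mW; first exact: le_trans (grid_ge n).
have gj0 : 0 <= g j by exact: le_trans (g_ge j).
move=> X mX; apply: (F_homo gj0); last exact: B_adapted.
by rewrite ge_min sp_grid_le.
Qed.

Let mV n j : (j <= n)%N -> measurable_fun
  [set: g_sigma_algebraType (F (sp_grid H n))]
  (V j : g_sigma_algebraType (F (sp_grid H n)) -> R).
Proof.
move=> jn; apply: measurable_fun_ifT => //; last exact: mval.
apply: measurable_fun_ler => //.
apply: (measurable_sum (T := g_sigma_algebraType (F (sp_grid H n))) _
  (h := fun k : 'I_j.+1 => a k)) => k.
apply: measurable_funM => //; apply: measurable_funX; apply: mval.
by rewrite (leq_trans _ jn)// -ltnS.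
Qed.

Let mS n : measurable_fun
  [set: g_sigma_algebraType (F (sp_grid H n))]
  (S n : g_sigma_algebraType (F (sp_grid H n)) -> R).
Proof.
apply: (measurable_sum (T := g_sigma_algebraType (F (sp_grid H n))) _
  (h := fun (j : 'I_n) w => V j w * (B (g j.+1) w - B (g j) w))) => j.
apply: measurable_funM; first by apply: mV; exact: ltnW.
by apply: measurable_funB; apply: mB => //; exact: ltnW.
Qed.

Let sub_measurable s : 0 <= s -> F s `<=` measurable.
Proof. by case: hF => _ + _; exact. Qed.

Let m_of n f : measurable_fun
  [set: g_sigma_algebraType (F (sp_grid H n))]
  (f : g_sigma_algebraType (F (sp_grid H n)) -> R) ->
  measurable_fun [set: Omega] f.
Proof.
have n0 : 0 <= sp_grid H n by exact: le_trans (grid_ge n).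
by move=> /(mW _ n0); exact: measurable_wrt_measurable (sub_measurable n0).
Qed.

(** By induction on the steps: [S n] and [V n] are known at time [sp_grid H n], and the next
    increment of [B] is independent of that past. *)
Let integral_S_sqr_le n :
  (\int[P]_w (S n w ^+ 2)%:E <=
   \int[P]_w (16 * \sum_(j < n) V j w ^+ 2 * (g j.+1 - g j))%:E)%E.
Proof.
elim: n => [|n IH].
  rewrite le_eqVlt; apply/orP; left; apply/eqP; apply: eq_integral => w _.
  by rewrite /S !big_ord0 expr0n mulr0.
(* A step of zero length adds nothing, and has to be set aside because the moment bound needs a
   positive deviation. *)
have [gE|/eqP gN] := eqVneq (g n.+1) (g n).
  under eq_integral do rewrite /S big_ord_recr/= gE subrr mulr0 addr0.
  by under [leRHS]eq_integral do rewrite big_ord_recr/= gE subrr mulr0 addr0.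
have {gN} gn : g n < g n.+1 by rewrite lt_neqAle g_le// andbT eq_sym; apply/eqP.
(* A step of positive length starts before [r], so its left end is not clipped and the increment
   starts at the grid time itself. *)
have gnE : g n = sp_grid H n.
  rewrite /g; apply/min_idPl; rewrite leNgt; apply/negP => rn.
  have rn1 : r <= sp_grid H n.+1 by rewrite (le_trans (ltW rn))// sp_grid_le.
  by move: gn; rewrite /g (min_idPr (ltW rn)) (min_idPr rn1) ltxx.
have n0 : 0 <= sp_grid H n by exact: le_trans (grid_ge n).
have mSO := m_of (@mS n).
have mVO : measurable_fun [set: Omega] (V n) by exact: m_of (mV (leqnn n)).
have mVOj (j : 'I_n) : measurable_fun [set: Omega] (V j) by exact: m_of (mV (leqnn j)).
have mg k : measurable_fun [set: Omega] (B (g k)).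
  have gk0 := le_trans t0 (g_ge k).
  exact: measurable_wrt_measurable (sub_measurable gk0) (B_adapted gk0).
have d0 : 0 < Num.sqrt (g n.+1 - g n) by rewrite sqrtr_gt0 subr_gt0.
have SS w : S n.+1 w = S n w + V n w * (B (g n.+1) w - B (g n) w).
  by rewrite /S big_ord_recr.
under eq_integral do rewrite SS.
apply: le_trans (integral_sqr_addM_indep (S := S n) (H := V n)
  (X := fun w => B (g n.+1) w - B (g n) w) (sF n0) (sub_measurable n0) d0 _ _ _ _) _.
- exact: measurable_funB.
- by move=> A X FA mX; apply: B_indep => //; rewrite gnE.
- by apply/(mW _ n0).
- by apply/(mW _ n0); exact: mV.
rewrite sqr_sqrtr ?dg_ge0//.
have mQ : measurable_fun [set: Omega]
    (fun w => (16 * \sum_(j < n) V j w ^+ 2 * (g j.+1 - g j))%:E).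
  apply/measurable_EFinP/measurable_funM => //; apply: (measurable_sum _
    (h := fun (j : 'I_n) w => V j w ^+ 2 * (g j.+1 - g j))) => j.
  by apply: measurable_funM => //; exact: measurable_funX.
have mR : measurable_fun [set: Omega]
    (fun w => (16 * (g n.+1 - g n) * V n w ^+ 2)%:E).
  by apply/measurable_EFinP/measurable_funM => //; exact: measurable_funX.
have mS2 : measurable_fun [set: Omega] (fun w => (S n w ^+ 2)%:E).
  by apply/measurable_EFinP/measurable_funX.
have Q0 w : (0 <= (16 * \sum_(j < n) V j w ^+ 2 * (g j.+1 - g j))%:E)%E.
  by rewrite lee_fin mulr_ge0// sumr_ge0// => j _; rewrite mulr_ge0 ?sqr_ge0.
have R0 w : (0 <= (16 * (g n.+1 - g n) * V n w ^+ 2)%:E)%E.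
  by rewrite lee_fin -mulrA mulr_ge0// mulr_ge0 ?sqr_ge0.
under eq_integral do rewrite EFinD.
rewrite ge0_integralD//; last by move=> w _; rewrite lee_fin sqr_ge0.
have QS w : (16 * \sum_(j < n.+1) V j w ^+ 2 * (g j.+1 - g j))%:E =
    ((16 * \sum_(j < n) V j w ^+ 2 * (g j.+1 - g j))%:E +
     (16 * (g n.+1 - g n) * V n w ^+ 2)%:E)%E.
  by rewrite big_ord_recr/= -EFinD; congr EFin; ring.
under [leRHS]eq_integral do rewrite QS.
by rewrite [leRHS]ge0_integralD// leeD2r.
Qed.

(** Chebyshev's inequality: the energy of the stopped process never exceeds [c], so the second
    moment of [S n] is at most [16 * c]. *)
Let S_tail n (e : R) : 0 <= c -> 0 < e ->
  (P [set w | (e <= `|S n w|)%R]%classic <= (16 * c / e ^+ 2)%:E)%E.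
Proof.
move=> c0 e0.
have mSO := m_of (@mS n).
have mVO (j : 'I_n) : measurable_fun [set: Omega] (V j) by exact: m_of (mV (leqnn j)).
have mS2 : measurable_fun [set: Omega] (fun w => (S n w ^+ 2)%:E).
  by apply/measurable_EFinP/measurable_funX.
have e20 : 0 < e ^+ 2 by rewrite exprn_gt0.
rewrite EFinM -lee_pdivrMr ?invr_gt0// invrK muleC.
have /le_trans -> // : ((e ^+ 2)%:E * P [set w | (e <= `|S n w|)%R]%classic <=
    \int[P]_w (S n w ^+ 2)%:E)%E.
  have := @le_integral_comp_abse _ _ _ P _ measurableT
    (fun w => (S n w ^+ 2)%:E) (e ^+ 2) id (@measurable_id _ _ _).
  move=> /(_ (fun _ => id) (fun _ _ _ _ => id) mS2 e20).
  rewrite setTI.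
  rewrite (_ : [set x | _]%classic = [set w | (e <= `|S n w|)%R]%classic); last first.
    have eS w : (e ^+ 2 <= `|S n w ^+ 2|) = (e <= `|S n w|).
      by rewrite normrX ler_pXn2r// nnegrE ?ltW.
    by apply/seteqP; split => w /=; rewrite lee_fin eS.
  under eq_integral do rewrite gee0_abs ?lee_fin ?sqr_ge0//.
  by [].
apply: (le_trans (integral_S_sqr_le n)).
apply: (@le_trans _ _ (\int[P]_w (16 * c)%:E)%E); last first.
  by rewrite integral_cst// [X in (_ * X)%E](_ : _ = 1%E) ?mule1//; exact: probability_setT.
apply: ge0_le_integral => //.
- move=> w _; rewrite lee_fin mulr_ge0// sumr_ge0// => j _.
  by rewrite mulr_ge0 ?sqr_ge0.
- apply/measurable_EFinP/measurable_funM => //; apply: (measurable_sum _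
    (h := fun (j : 'I_n) w => V j w ^+ 2 * (g j.+1 - g j))) => j.
  by apply: measurable_funM => //; exact: measurable_funX.
- move=> w _; rewrite lee_fin ler_pM2l//.
  apply: le_trans (truncated_sum_le n c0 (a_ge0 ^~ w)).
  apply: ler_sum => j _; rewrite /V; case: ifPn => // _.
  by rewrite expr0n mul0r.
Qed.

(** The grid intervals are disjoint, so the square of the step function is the sum of the squares;
    clipping the intervals at [r] only discards energy. *)
Let sum_a_le_integral (T : R) w : r <= T ->
  ((\sum_(j < sp_size H) a j w)%:E <=
   \int[lebesgue_measure]_(s in `[t, T]) (sp_fun H s w ^+ 2)%:E)%E.
Proof.
move=> rT.
pose I j : set R := `]g j, g j.+1]%classic.
have mI j : measurable_fun `[t, T] (fun s => (\1_(I j) s)%:E).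
  by apply/measurable_EFinP/measurable_indic; exact: measurable_itv.
have aE : ((\sum_(j < sp_size H) a j w)%:E = \int[lebesgue_measure]_(s in `[t, T])
    \sum_(j < sp_size H) ((sp_val H j w ^+ 2)%:E * (\1_(I j) s)%:E))%E.
  rewrite ge0_integral_sum//; last 2 first.
  - by move=> j; apply: emeasurable_funM => //; exact: mI.
  - by move=> j s _; rewrite -EFinM lee_fin mulr_ge0 ?sqr_ge0.
  rewrite -sumEFin; apply: eq_bigr => j _.
  rewrite ge0_integralZl//; last 2 first.
  - exact: mI.
  - by rewrite lee_fin sqr_ge0.
  rewrite integral_indic//; last exact: measurable_itv.
  rewrite setIidl; last first.
    move=> s; rewrite /I /= !in_itv/= => /andP[s1 s2].
    rewrite (le_trans (g_ge j) (ltW s1)) (le_trans s2)//.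
    by rewrite (le_trans _ rT)// ge_min lexx orbT.
  rewrite [X in (_ * X)%E](lebesgue_measure_itv `]g j, g j.+1])/= lte_fin.
  case: ltP => gj; first by rewrite -EFinM.
  have -> : a j w = 0; last by rewrite mule0.
  by rewrite /a (_ : g j.+1 = g j) ?subrr ?mulr0//; apply/eqP; rewrite eq_le gj g_le.
rewrite aE; apply: ge0_le_integral => //.
- by move=> s _; apply: sume_ge0 => j _; rewrite -EFinM lee_fin mulr_ge0 ?sqr_ge0.
- apply: emeasurable_sum => j; apply: emeasurable_funM => //.
  exact: mI.
- apply/measurable_EFinP/measurable_funX; apply: (measurable_sum _
    (h := fun (j : 'I_(sp_size H)) s => sp_val H j w * \1_(`]sp_grid H j, sp_grid H j.+1]) s)) => j.
  exact: measurable_funM.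
move=> s _; rewrite sumEFin lee_fin /sp_fun.
rewrite (sqr_sum_exclusive (fun j : 'I_(sp_size H) => sp_val H j w)
  (e := fun j : 'I_(sp_size H) => \1_(`]sp_grid H j, sp_grid H j.+1]) s)).
- apply: ler_sum => j _; rewrite ler_wpM2l ?sqr_ge0// !indicE ler_nat.
  case: (boolP (s \in I j)) => //; rewrite inE /I /= in_itv/= => /andP[].
  rewrite gt_min le_min => s1 /andP[s2 s3].
  rewrite mem_set//= in_itv/= s2 andbT.
  by move: s1 => /orP[//|]; rewrite ltNge s3.
- by move=> j; rewrite indicE; case: (_ \in _); rewrite ?expr1n ?expr0n.
- suff excl (i j : nat) : (i < j)%N -> \1_(`]sp_grid H i, sp_grid H i.+1]) s *
      \1_(`]sp_grid H j, sp_grid H j.+1]) s = 0 :> R.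
    move=> i j; rewrite neq_ltn => /orP[/excl//|/excl].
    by rewrite mulrC.
  move=> ij; rewrite !indicE -natrM mulnb; case: andP => // -[].
  rewrite !inE/= !in_itv/= => /andP[_ s1] /andP[s2 _].
  by have := sp_grid_le ij; rewrite leNgt (lt_le_trans s2 s1).
Qed.

(** While the energy stays below [c] the truncation never acts, and [S n] is the elementary
    integral. The outer measure spares a proof that the energy is measurable in [w]. *)
Lemma sp_integral_tail (T e : R) : r <= T -> 0 <= c -> 0 < e ->
  ((P^*)%mu [set w | (e%:E <= `|sp_integral H B r w|%:E)%E]%classic <=
   (P^*)%mu [set w | (c%:E <= \int[lebesgue_measure]_(s in `[t, T])
      (sp_fun H s w ^+ 2)%:E)%E]%classic + (16 * c / e ^+ 2)%:E)%E.
Proof.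
move=> rT c0 e0; set n := sp_size H.
have mSO := m_of (@mS n).
have mA : measurable [set w | (e <= `|S n w|)%R]%classic.
  rewrite -[X in measurable X]setTI.
  apply: (measurable_fun_le (f := fun=> e) (g := fun w => `|S n w|)) => //.
  by apply: measurableT_comp.
apply: le_trans (leeD2l _ (S_tail n c0 e0)).
rewrite -(measurable_mu_extE P mA).
apply: le_trans (outer_measureU2 _ _ _); apply: le_outer_measure => w /=.
rewrite lee_fin => eS; case: (leP c%:E (\int[lebesgue_measure]_(s in `[t, T])
      (sp_fun H s w ^+ 2)%:E)%E) => [?|intlt]; [by left|right].
have An : \sum_(j < n) a j w <= c.
  by rewrite -lee_fin (le_trans (sum_a_le_integral w rT))// ltW.
rewrite (_ : S n w = sp_integral H B r w)//; apply: eq_bigr => j _.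
congr (_ * _); rewrite /V ifT// (le_trans _ An)//.
rewrite -(big_mkord xpredT (fun k => a k w)) -(big_mkord xpredT (fun k => a k w)).
by rewrite (big_cat_nat (n := j.+1) (p := n))//= lerDl sumr_ge0.
Qed.

End truncated_martingale.

(** * The Ito integral of zero *)

Lemma exists_invS_lt (R : realType) (e : R) : 0 < e -> exists k : nat, (k.+1%:R^-1 < e)%R.
Proof.
by move=> e0; have [k _ /(_ k (leqnn k))] := near_infty_natSinv_lt (PosNum e0); exists k.
Qed.

(** Intersecting measurable covers of total mass below [k.+1%:R^-1] yields a measurable null set
    that contains [N]. *)
Lemma mu_ext0_negligible d (T : measurableType d) (R : realType)
    (P : {measure set T -> \bar R}) (N : set T) :
  (P^*)%mu N = 0%E -> P.-negligible N.
Proof.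
move=> N0.
have /choice[A hA] (k : nat) : exists A : (set T)^nat, measurable_cover N A /\
    (\sum_(n <oo) P (A n) < (k.+1%:R^-1)%R%:E)%E.
  have : ((P^*)%mu N < (k.+1%:R^-1)%R%:E)%E by rewrite N0 lte_fin.
  by move=> /ereal_inf_lt[_ [A NA <-] lt]; exists A.
have mA k : measurable (\bigcup_n A k n).
  by apply: bigcupT_measurable => n; have [[+ _] _] := hA k; exact.
exists (\bigcap_k \bigcup_n A k n); split.
- exact: bigcapT_measurable.
- apply/eqP; rewrite eq_le measure_ge0 andbT; apply/lee_addgt0Pr => e e0.
  rewrite add0e; have [k ke] := exists_invS_lt e0.
  apply: (@le_trans _ _ (P (\bigcup_n A k n))).
    apply: le_measure; rewrite ?inE//; first exact: bigcapT_measurable.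
    exact: bigcap_inf.
  have [[mAk _] /ltW lt] := hA k.
  apply: (@le_trans _ _ (\sum_(n <oo) P (A k n))%E).
    exact: measure_sigma_subadditive.
  by rewrite (le_trans lt)// lee_fin ltW.
- by move=> w Nw k _; have [[_ NA] _] := hA k; exact: NA.
Qed.

(** Density of the rationals settles the interior points. The endpoints may be irrational and are
    treated as separate hypotheses. *)
Lemma within_continuous_rat_eq0 (R : realType) (a b : R) (f : R -> R) : a < b ->
  {within `[a, b], continuous f} -> f a = 0 -> f b = 0 ->
  (forall q : rat, ratr q \in `[a, b] -> f (ratr q) = 0) ->
  forall x, x \in `[a, b] -> f x = 0.
Proof.
move=> ab cf fa fb fq x; rewrite in_itv/= => /andP[].
rewrite le_eqVlt => /orP[/eqP <-//|ax]; rewrite le_eqVlt => /orP[/eqP ->//|xb].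
have xab : x \in `]a, b[ by rewrite in_itv/= ax xb.
have cfx := within_continuous_continuous ab cf xab.
apply/eqP; rewrite -normr_eq0; apply/eqP; apply: le_anti; rewrite normr_ge0 andbT.
apply/ler_addgt0Pr => e e0; rewrite add0r.
have : \forall y \near nbhs x, (y \in `]a, b[) /\ (`|f x - f y| < e).
  apply: filterI; first exact: near_in_itvoo.
  by move/cvgrPdist_lt : cfx; exact.
move=> /nbhs_ballP[e' /= e'0 he'].
have [q] : exists q : rat, x - e' < ratr q < x + e'.
  have /rat_in_itvoo[q] : x - e' < x + e' by rewrite ltrD2l; move: e'0; lra.
  by rewrite in_itv/=; exists q.
move=> /andP[q1 q2]; have [|qab] := he' (ratr q).
  by rewrite /ball/= ltr_norml; apply/andP; split; lra.
rewrite fq ?subr0; first by move/ltW.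
by move: qab; rewrite !in_itv/= => /andP[/ltW -> /ltW ->].
Qed.

Section ito_integral0.
Context d (Omega : measurableType d) (R : realType) (P : probability Omega R).
Variables (F : R -> set (set Omega)) (B : R -> Omega -> R).
Hypothesis hF : filtration F.
Hypothesis B_adapted : forall t, 0 <= t -> measurable_wrt (F t) (B t).
Hypothesis B_indep : forall s t, 0 <= s -> s < t -> forall A X, F s A -> measurable X ->
  P (A `&` (fun w => B t w - B s w) @^-1` X) =
  (P A * normal_prob 0%R (Num.sqrt (t - s)) X)%E.
Variables (t T : R) (t0 : 0 <= t) (I : R -> Omega -> R).
Hypothesis itoI : is_ito_integral P F B t T (fun _ _ => 0) I.

Lemma ito_integral0_pointwise r : r \in `[t, T] -> {ae P, forall w, I r w = 0}.
Proof.
move=> rtT; have /andP[tr rT] : t <= r <= T by move: rtT; rewrite in_itv.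
case: itoI => _ _ [Hn [cvgH /(_ r rtT) cvgI]].
(* If [I r w] is at least [2 * e] in absolute value, then the approximation error or the elementary
   integral is at least [e]; the tail estimate bounds the latter. *)
have bound e c n : 0 < e -> 0 <= c ->
    ((P^*)%mu [set w | ((2 * e)%:E <= `|I r w|%:E)%E] <=
     (P^*)%mu [set w | (e%:E <= `|sp_integral (Hn n) B r w - I r w|%:E)%E] +
     ((P^*)%mu [set w | (c%:E <= \int[lebesgue_measure]_(s in `[t, T])
        ((sp_fun (Hn n) s w - 0) ^+ 2)%:E)%E] + (16 * c / e ^+ 2)%:E))%E.
  move=> e0 c0.
  have -> : [set w | (c%:E <= \int[lebesgue_measure]_(s in `[t, T])
        ((sp_fun (Hn n) s w - 0) ^+ 2)%:E)%E] =
      [set w | (c%:E <= \int[lebesgue_measure]_(s in `[t, T]) (sp_fun (Hn n) s w ^+ 2)%:E)%E].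
    by apply/funext => w /=; under eq_integral do rewrite subr0.
  apply: le_trans (leeD2l _ (sp_integral_tail hF B_adapted B_indep t0 tr (Hn n) rT c0 e0)).
  apply: le_trans (outer_measureU2 _ _ _); apply: le_outer_measure => w /=.
  rewrite !lee_fin => eI.
  case: (leP e `|sp_integral (Hn n) B r w|) => [|h]; [by right|left].
  have := ler_normB (sp_integral (Hn n) B r w) (sp_integral (Hn n) B r w - I r w).
  rewrite opprB addrC subrK; lra.
have I_small e : 0 < e -> (P^*)%mu [set w | ((2 * e)%:E <= `|I r w|%:E)%E] = 0%E.
  move=> e0; apply/eqP; rewrite eq_le outer_measure_ge0 andbT.
  apply/lee_addgt0Pr => eta eta0; rewrite add0e.
  (* Chosen so that [16 * c / e ^+ 2] is [eta]; the two other terms of [bound] tend to 0 with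
     [n]. *)
  pose c := eta * e ^+ 2 / 16.
  have c0 : 0 < c by rewrite divr_gt0// mulr_gt0// exprn_gt0.
  have etaE : eta%:E = (0 + (0 + (16 * c / e ^+ 2)%:E))%E.
    by rewrite !add0e /c; congr EFin; field; rewrite gt_eqF.
  have dfd0 (x : R) : (0%:E +? x%:E)%E by [].
  have dfd1 : (0%:E +? (0 + (16 * c / e ^+ 2)%:E))%E by rewrite add0e.
  have cv := cvgeD dfd1 (cvgI e e0)
    (cvgeD (dfd0 _) (cvgH c c0) (@cvg_cst _ (16 * c / e ^+ 2)%:E _ \oo _)).
  have {}cv := cv eventually_filter eventually_filter eventually_filter.
  rewrite etaE -(cvg_lim _ cv)//; apply: lime_ge; first by apply/cvg_ex; eexists; exact: cv.
  by apply: nearW => n; apply: bound => //; exact: ltW.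
apply: mu_ext0_negligible; apply/eqP; rewrite eq_le outer_measure_ge0 andbT.
pose Ak k := [set w | ((2 * k.+1%:R^-1)%R%:E <= `|I r w|%:E)%E].
have sub : ~` [set w | I r w = 0] `<=` \bigcup_k Ak k.
  move=> w /= /eqP Iw; have Iw0 : 0 < `|I r w| / 2 by rewrite divr_gt0// normr_gt0.
  have [k hk] := exists_invS_lt Iw0; exists k => //; rewrite /Ak /= lee_fin.
  by move: hk; rewrite ltr_pdivlMr// mulrC => /ltW.
apply: (le_trans (le_outer_measure _ _ _ sub)).
apply: (le_trans (outer_measure_sigma_subadditive _ _)).
by rewrite eseries0// => k _ _; exact: I_small.
Qed.

(** Countably many null sets, one for each rational time and each endpoint, are discarded; path
    continuity then covers all times at once. *)
Lemma ito_integral0 : {ae P, forall w, forall r, r \in `[t, T] -> I r w = 0}.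
Proof.
have [Tt|tT] := leP T t.
  have [tT|/eqP tT] := eqVneq t T; last first.
    by apply: aeW => w r; rewrite in_itv/= => /andP[tr rT]; exfalso; apply: tT; lra.
  have : t \in `[t, T] by rewrite in_itv/= lexx tT lexx.
  move=> /ito_integral0_pointwise; apply: filterS => w I0 r.
  by rewrite in_itv/= -tT => /le_anti <-.
have tI : t \in `[t, T] by rewrite in_itv/= lexx ltW.
have TI : T \in `[t, T] by rewrite in_itv/= lexx ltW.
(* Rationals are enumerated by [unpickle], so that the countable intersection runs over [nat]. *)
have rI : {ae P, forall w, forall n, forall q : rat, unpickle n = Some q ->
    ratr q \in `[t, T] -> I (ratr q) w = 0}.
  apply: ae_foralln => n; case E : (unpickle n) => [q|]; last by apply: aeW.
  have [qI|qI] := boolP (ratr q \in `[t, T]); last first.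
    by apply: aeW => w q' [<-]; rewrite (negbTE qI).
  by have := ito_integral0_pointwise qI; apply: filterS => w Iw q' [<-].
case: itoI => _ cI _.
apply: filterS (filterI (filterI cI rI)
  (filterI (ito_integral0_pointwise tI) (ito_integral0_pointwise TI))).
move=> w [[cIw rIw] [It IT]].
apply: within_continuous_rat_eq0 => //= q; exact: rIw (pickleK q).
Qed.

End ito_integral0.

(** * Monotonicity of the constraint set *)

Lemma normr_mxP (R : realType) m n (A : 'M[R]_(m, n)) (c : R) : 0 <= c ->
  `|A| <= c <-> forall i j, `|A i j| <= c.
Proof.
move=> c0; rewrite /Num.norm/= mx_normrE; split=> [+ i j|h].
  by apply: le_trans; exact: (le_bigmax _ (fun ij => `|A ij.1 ij.2|) (i, j)).
by apply: bigmax_le => // -[i j] _; exact: h.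
Qed.

Lemma normr_mx_entry_le (R : realType) m n (A : 'M[R]_(m, n)) i j : `|A i j| <= `|A|.
Proof. exact: (normr_mxP A (normr_ge0 A)).1 (lexx _) i j. Qed.

Lemma enorm_entry_le (R : realType) n (x : 'cV[R]_n) i : `|x i 0| <= enorm x.
Proof.
rewrite -sqrtr_sqr ler_sqrt; last by apply: sumr_ge0 => j _; exact: sqr_ge0.
by rewrite (bigD1 i)//= lerDl sumr_ge0// => j _; exact: sqr_ge0.
Qed.

Lemma stTE (R : realType) N (z : state R N) : stT z = z (lshift (N + N) 0) 0.
Proof. by rewrite /stT mxE. Qed.

Lemma stQE (R : realType) N (z : state R N) i : stQ z i 0 = z (rshift 1 (lshift N i)) 0.
Proof. by rewrite /stQ !mxE. Qed.

Lemma stDE (R : realType) N (z : state R N) i : stD z i 0 = z (rshift 1 (rshift N i)) 0.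
Proof. by rewrite /stD !mxE. Qed.

Section constraint_set.
Context (R : realType) (N M : nat) (nw : network R N M).
Hypothesis hN : (0 < N)%N.

Let i0 : 'I_N := Ordinal hN.

Lemma has_lbound_range_ord (f : 'I_N -> R) : has_lbound (range f).
Proof.
exists (- \sum_i `|f i|) => _ [i _ <-].
rewrite lerNl (le_trans (ler_norm _))// normrN (bigD1 i)//= lerDl.
by rewrite sumr_ge0.
Qed.

Lemma inf_range_balance_le (D q : 'cV[R]_N) (phi : 'cV[R]_M) i :
  inf (range (balance nw D q phi)) <= balance nw D q phi i.
Proof. by apply: ge_inf; [exact: has_lbound_range_ord|exists i]. Qed.

(** The balance at the single node [i0] bounds the minimum over the nodes: [q] is capped by [Q], the
    flows by their limits, and losses only lower it. This keeps the supremum in [Gfun] from being a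
    default value. *)
Lemma has_ubound_feasible (Q D : 'cV[R]_N) :
  has_ubound [set inf (range (balance nw D x.1 x.2)) | x in feasible nw Q].
Proof.
exists (Q i0 0 - D i0 0 +
  \sum_(e in incident nw i0) (`|flow_min nw e| + `|flow_max nw e|)).
move=> _ [[q phi] /= [hq hphi] <-].
apply: (le_trans (inf_range_balance_le D q phi i0)).
rewrite /balance; apply: lerD; first by rewrite lerD2r; case/andP: (hq i0).
apply: ler_sum => e _; apply: (@le_trans _ _ (sgn nw e i0 * phi e 0)).
  by rewrite gerBl mulr_ge0 ?sqr_ge0// divr_ge0 ?resistance_ge0.
have /andP[lo hi] := hphi e.
have : sgn nw e i0 * phi e 0 <= `|phi e 0|.
  rewrite (le_trans (ler_norm _))// normrM /sgn.
  by case: ifP => _; rewrite ?normrN1 ?normr1 mul1r.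
move=> /le_trans; apply; rewrite ler_norml; apply/andP; split.
  have := ler_norm (- flow_min nw e); have := normr_ge0 (flow_max nw e).
  by rewrite normrN; lra.
have := ler_norm (flow_max nw e); have := normr_ge0 (flow_min nw e); lra.
Qed.

(* A feasible [q] for [Q] is turned into the feasible [q + (Q' - Q)] for [Q']. *)
Lemma Gfun_le (Q D Q' D' : 'cV[R]_N) : (forall i, 0 <= Q i 0) ->
  (forall i, Q i 0 <= Q' i 0) ->
  (forall i, D' i 0 - D i 0 <= Q' i 0 - Q i 0) ->
  Gfun nw Q D <= Gfun nw Q' D'.
Proof.
move=> Q0 QQ' DQ; apply: ge_sup.
  (* Since [Q >= 0], the point [q = 0] with minimal flows is feasible, so the supremum is over a
     nonempty set. *)
  exists (inf (range (balance nw D 0 (\col_e flow_min nw e)))).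
  exists (0, \col_e flow_min nw e) => //; split=> /= [i|e]; rewrite mxE.
    by rewrite lexx Q0.
  by rewrite lexx flow_min_le_max.
move=> _ [[q phi] /= [hq hphi] <-].
apply: (@le_trans _ _ (inf (range (balance nw D' (q + (Q' - Q)) phi)))).
  apply: lb_le_inf; first by exists (balance nw D' (q + (Q' - Q)) phi i0), i0.
  move=> _ [i _ <-]; apply: (le_trans (inf_range_balance_le D q phi i)).
  rewrite /balance lerD2r !mxE; have := DQ i; lra.
apply: sup_upper_bound; last first.
  exists (q + (Q' - Q), phi) => //; split=> //= i; rewrite !mxE.
  have /andP[q0 qQ] := hq i; have := QQ' i.
  by move=> QQ'i; apply/andP; split; lra.
split; last exact: has_ubound_feasible.
exists (inf (range (balance nw D' (q + (Q' - Q)) phi))).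
exists (q + (Q' - Q), phi) => //; split=> //= i; rewrite !mxE.
have /andP[q0 qQ] := hq i; have := QQ' i.
by move=> QQ'i; apply/andP; split; lra.
Qed.

Lemma constraint_set_mono (z z' : state R N) : constraint_set nw z ->
  (forall i, stQ z i 0 <= stQ z' i 0) ->
  (forall i, stD z' i 0 - stD z i 0 <= stQ z' i 0 - stQ z i 0) ->
  constraint_set nw z'.
Proof.
move=> [Q0 G0] QQ' DQ; split=> /= [i|]; first exact: le_trans (QQ' i).
exact: le_trans (Gfun_le Q0 QQ' DQ).
Qed.

(** Translation by [z' - z] carries a ball around [z] to a ball around [z'], and the monotonicity
    applies to each of its points. *)
Lemma interior_constraint_set_mono (z z' : state R N) : (constraint_set nw)° z ->
  (forall i, stQ z i 0 <= stQ z' i 0) ->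
  (forall i, stD z' i 0 - stD z i 0 <= stQ z' i 0 - stQ z i 0) ->
  (constraint_set nw)° z'.
Proof.
move=> /nbhs_ballP[e /= e0 ze] QQ' DQ; apply/nbhs_ballP; exists e => //= y z'y.
have Cy : constraint_set nw (y - (z' - z)).
  apply: ze; move: z'y; rewrite -!ball_normE /=.
  by rewrite opprB addrA [z + _]addrC subrK.
apply: (constraint_set_mono Cy) => i; rewrite ?stQE ?stDE !mxE.
  by have := QQ' i; rewrite !stQE; lra.
by have := DQ i; rewrite !stQE !stDE; lra.
Qed.

(** A point within [g / 2] of [z'] differs from it by less than [g] in each component of [Q] and of
    [Q - D], so it still dominates [z]. *)
Lemma constraint_set_interior (z z' : state R N) (g : R) : 0 < g ->
  constraint_set nw z ->
  (forall i, g <= stQ z' i 0 - stQ z i 0) ->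
  (forall i, g <= (stQ z' i 0 - stQ z i 0) - (stD z' i 0 - stD z i 0)) ->
  (constraint_set nw)° z'.
Proof.
move=> g0 Cz gQ gD; apply/nbhs_ballP; exists (g / 2) => /=; first by rewrite divr_gt0.
move=> y; rewrite -ball_normE /= => z'y.
have near k : `|z' k 0 - y k 0| < g / 2.
  by apply: le_lt_trans z'y; have := normr_mx_entry_le (z' - y) k 0; rewrite !mxE.
apply: (constraint_set_mono Cz) => i.
  have := gQ i; have := near (rshift 1 (lshift N i)).
  by rewrite !stQE ltr_norml => /andP[]; lra.
have := gD i; have := near (rshift 1 (lshift N i)); have := near (rshift 1 (rshift N i)).
by rewrite !stQE !stDE !ltr_norml => /andP[? ?] /andP[? ?]; lra.
Qed.

End constraint_set.

(** * The feedback control *)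

Lemma within_continuous_entries (R : realType) n (A : set R) (X : R -> 'cV[R]_n) :
  (forall k, {within A, continuous (fun r => X r k 0)}) ->
  {within A, continuous X}.
Proof.
move=> cX x; apply/cvgrPdist_le => e e0.
have : \forall y \near (x : subspace A), forall k, `|X x k 0 - X y k 0| <= e.
  apply: (@filter_forall _ _ _ _ (nbhs_filter (x : subspace A))) => k.
  by move/cvgrPdist_le : (cX k x); exact.
apply: filterS => y hy; apply/normr_mxP; first exact: ltW.
by move=> i j; rewrite ord1 !mxE.
Qed.

Section primitive.
Context (R : realType) (t T : R) (f : R -> R).
Hypothesis cf : continuous f.

Lemma continuous_integrable_itv a b :
  lebesgue_measure.-integrable `[a, b] (EFin \o f).
Proof.
apply: continuous_compact_integrable; first exact: segment_compact.
exact: continuous_subspaceT.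
Qed.

(** The integral from [t] is the integral from 0 of [f] cut off before [t], which also covers the
    times [r < t], where it vanishes. *)
Lemma within_continuous_Rintegral : 0 <= t <= T ->
  {within `[0, T], continuous (fun r => \int[lebesgue_measure]_(s in `[t, r]) f s)}.
Proof.
move=> /andP[t0 tT].
pose g := f \_ `[t, +oo[.
have sub (r : R) : 0 <= r -> `[t, r]%classic = `[0, r]%classic `&` `[t, +oo[%classic :> set R.
  move=> r0; apply/seteqP; split => x /=; rewrite !in_itv/= ?andbT.
    by move=> /andP[tx xr]; rewrite xr (le_trans t0 tx).
  by move=> [/andP[_ ->] ->].
have ig : lebesgue_measure.-integrable `[0, T] (EFin \o g).
  rewrite -restrict_EFin; apply/integrable_restrict => //.
  by rewrite -sub ?(le_trans t0)//; exact: continuous_integrable_itv.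
have := parameterized_integral_continuous (le_trans t0 tT) ig.
apply: subspace_eq_continuous => r; rewrite inE/= in_itv/= => /andP[r0 _].
by rewrite /parameterized_integral /from_subspace sub// Rintegral_mkcondr.
Qed.

End primitive.

Section model.
Context (R : realType) (N : nat) (md : model R N).

Definition clamp_time (s : R) : R := Num.max 0 (Num.min s (horizon md)).

Lemma clamp_time_in s : clamp_time s \in `[0, horizon md].
Proof.
by rewrite in_itv/= le_max lexx/= ge_max (ltW (horizon_gt0 md)) ge_min lexx orbT.
Qed.

Lemma clamp_time_lipschitz s s' : `|clamp_time s - clamp_time s'| <= `|s - s'|.
Proof.
have := horizon_gt0 md; rewrite /clamp_time /Num.max /Num.min.
set T := horizon md => T0.
have [a1 a2] : - (s - s') <= `|s - s'| /\ s - s' <= `|s - s'|.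
  by split; [rewrite -normrN|]; exact: ler_norm.
rewrite ler_norml; case: ifPn; case: ifPn; case: ifPn; case: ifPn;
  rewrite -?leNgt => *; apply/andP; split; lra.
Qed.

Lemma clamped_drift_lipschitz : exists2 L : R, 0 < L &
  forall s s', `|clamped_drift md s - clamped_drift md s'| <= L * `|s - s'|.
Proof.
have lip : \forall L \near +oo,
    forall s s', `|clamped_drift md s - clamped_drift md s'| <= L * `|s - s'|.
  have := demand_drift_lipschitz md.
  have := nbhs_pinfty_gt (num_real (0 : R)).
  apply: filterS2 => L L0 hL s s'.
  have := hL (clamp_time s, clamp_time s'); rewrite /= => h.
  apply: (le_trans (h _)).
    by split; rewrite /= in_itv/= andbT le_max lexx.
  by rewrite ler_pM2l// clamp_time_lipschitz.
(* The bound holds for all large constants; a positive one is picked among them. *)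
have [L [L0 hL]] : exists L : R, 0 < L /\
    forall s s', `|clamped_drift md s - clamped_drift md s'| <= L * `|s - s'|.
  apply: (@filter_ex _ (+oo : set_system R)).
  by apply: filterI => //; exact: nbhs_pinfty_gt.
by exists L.
Qed.

(** The least admissible growth rate of capacity that keeps up with demand at every node. *)
Definition matching_rate (s : R) : 'cV[R]_N :=
  \col_i Num.max (clamped_drift md s i 0) 0.

Lemma matching_rate_ge0 s i : 0 <= matching_rate s i 0.
Proof. by rewrite mxE le_max lexx orbT. Qed.

Lemma matching_rate_ge s i : clamped_drift md s i 0 <= matching_rate s i 0.
Proof. by rewrite mxE le_max lexx. Qed.

Lemma matching_rate_dist s s' i : `|matching_rate s i 0 - matching_rate s' i 0| <=
  `|clamped_drift md s - clamped_drift md s'|.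
Proof.
apply: (@le_trans _ _ `|clamped_drift md s i 0 - clamped_drift md s' i 0|); last first.
  by have := normr_mx_entry_le (clamped_drift md s - clamped_drift md s') i 0; rewrite !mxE.
rewrite !mxE; set a := clamped_drift md s i 0; set b := clamped_drift md s' i 0.
have [a1 a2] : - (a - b) <= `|a - b| /\ a - b <= `|a - b|.
  by split; [rewrite -normrN|]; exact: ler_norm.
rewrite /Num.max ler_norml; case: ifPn; case: ifPn; rewrite -?leNgt => *;
  apply/andP; split; lra.
Qed.

Definition budget_sup : R :=
  sup [set \sum_i unit_cost md i 0 * Num.max (demand_drift md s i 0) 0
          | s in `[0, horizon md]].

(** Clamping brings [s] into the horizon, so the cost is one of the values under the supremum, which
    is finite because the demand drift is bounded. *)
Lemma matching_rate_cost_le s :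
  \sum_i unit_cost md i 0 * matching_rate s i 0 <= budget_sup.
Proof.
apply: ub_le_sup; last first.
  exists (clamp_time s); first exact: clamp_time_in.
  by apply: eq_bigr => i _; rewrite mxE.
have [K K0 hK] := ex_strict_bound_gt0 (demand_drift_bounded md).
exists (\sum_i unit_cost md i 0 * K) => _ [s' /= hs' <-].
move: hs'; rewrite in_itv/= => /andP[s'0 _].
apply: ler_sum => i _; rewrite ler_wpM2l ?(ltW (unit_cost_gt0 _ _))//.
rewrite ge_max (ltW K0) andbT (le_trans (ler_norm _))//.
apply: le_trans (normr_mx_entry_le _ _ _) (ltW (hK _ _)).
by rewrite /= in_itv/= s'0.
Qed.

(** Depends on the state through its time coordinate only, so the controlled equation can be solved
    by plain integration. *)
Definition feedback (z : state R N) : control R N :=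
  (matching_rate (stT z), const_mx 1).

Lemma volatility_eq0 z (mu : 'cV[R]_N) : volatility md z (mu, const_mx 1) = 0.
Proof.
apply/matrixP => i j; rewrite !mxE; case: splitP => k _; rewrite !mxE//.
by case: splitP => l _; rewrite !mxE// subrr mulr0 mul0rn.
Qed.

Lemma feedback_Uset z : budget_sup <= budget md -> Uset md (feedback z).
Proof.
move=> hb; split=> [i||i] /=.
- exact: matching_rate_ge0.
- exact: le_trans (matching_rate_cost_le _) hb.
- by rewrite mxE lexx ler01.
Qed.

Lemma feedback_lipschitz (A : set (state R N)) : [lipschitz feedback z | z in A].
Proof.
have [L L0 hL] := clamped_drift_lipschitz.
apply: filterS (nbhs_pinfty_ge (num_real L)) => K LK [z z'] _ /=.
have K0 : 0 <= K by rewrite (le_trans (ltW L0)).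
rewrite prod_normE/= ge_max subrr normr0 mulr_ge0// andbT.
apply/normr_mxP; first by rewrite mulr_ge0.
move=> i j; rewrite ord1 [X in `|X|]mxE [X in _ + X]mxE.
apply: (le_trans (matching_rate_dist _ _ _)).
apply: (le_trans (hL _ _)).
apply: (@le_trans _ _ (K * `|stT z - stT z'|)); first by rewrite ler_wpM2r.
rewrite ler_wpM2l// !stTE.
by have := normr_mx_entry_le (z - z') (lshift (N + N) 0) 0; rewrite !mxE.
Qed.

End model.

(** * The controlled trajectory *)

Lemma measurable_wrt_cst d (Omega : measurableType d) (R : realType)
    (G : set (set Omega)) (c : R) : sigma_algebra setT G ->
  measurable_wrt G (fun _ => c).
Proof.
move=> [G0 GC _] B _; have [Bc|Bc] := pselect (B c).
  rewrite (_ : _ @^-1` _ = setT); last by apply/seteqP; split.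
  by rewrite -(setD0 setT); exact: GC.
by rewrite (_ : _ @^-1` _ = set0)//; apply/seteqP; split => w.
Qed.

(** The simple process without steps serves as every approximant. *)
Lemma is_ito_integral_cst0 d (Omega : measurableType d) (R : realType)
    (P : probability Omega R) (F : R -> set (set Omega)) (B : R -> Omega -> R)
    (t T : R) : sigma_algebra setT (F t) ->
  is_ito_integral P F B t T (fun _ _ => 0) (fun _ _ => 0).
Proof.
move=> sF; split.
- by apply: aeW => w; exact: measurable_cst.
- by apply: aeW => w x; exact: cvg_cst.
have bnd : exists c : R, forall (j : nat) (w : Omega), `|(fun _ _ => 0 : R) j w| <= c.
  by exists 0 => j w; rewrite normr0.
pose H0 := @SimpleProcess d Omega R F t 0%N (fun _ => t) (fun _ _ => 0)
  (lexx t) (fun _ _ _ => lexx t) (fun _ => measurable_wrt_cst 0 sF) bnd.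
have cvg0 (Y : nat -> Omega -> \bar R) : (forall n w, Y n w = 0%E) -> cvg0_prob P Y.
  move=> Y0 e e0; rewrite (_ : (fun _ => _) = (fun=> 0%E)); first exact: cvg_cst.
  apply/funext => n; rewrite (_ : [set w | _] = set0) ?outer_measure0//.
  by apply/seteqP; split => w //=; rewrite Y0 lee_fin leNgt e0.
exists (fun _ => H0); split=> [|r _]; apply: cvg0 => _ w.
  rewrite integral0_eq// => s _.
  by rewrite /sp_fun big_ord0 subrr expr0n.
by rewrite /sp_integral big_ord0 subrr normr0.
Qed.

Section trajectory.
Context (R : realType) (N : nat) (md : model R N).
Implicit Types (z : state R N) (t s r : R).

Definition speed s : state R N :=
  col_mx (const_mx 1) (col_mx (matching_rate md s) (clamped_drift md s)).

Lemma drift_feedback z : drift md z (feedback md z) = speed (stT z).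
Proof. by []. Qed.

(** Time runs at unit speed from [stT z], hence the argument of [speed]. For [r <= t] the integral
    vanishes, so the state rests at [z] before time [t]. *)
Definition trajectory t z r : state R N :=
  \col_k (z k 0 + \int[lebesgue_measure]_(s in `[t, r]) speed (stT z + (s - t)) k 0).

Lemma speed0 s : speed s (lshift (N + N) 0) 0 = 1.
Proof. by rewrite /speed col_mxEu mxE. Qed.

Lemma speedQ s i : speed s (rshift 1 (lshift N i)) 0 = matching_rate md s i 0.
Proof. by rewrite /speed col_mxEd col_mxEu. Qed.

Lemma speedD s i : speed s (rshift 1 (rshift N i)) 0 = clamped_drift md s i 0.
Proof. by rewrite /speed !col_mxEd. Qed.

Lemma continuous_speed s0 k : continuous (fun s => speed (s0 + s) k 0).
Proof.
have [L L0 hL] := clamped_drift_lipschitz md.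
have lip s s' : `|speed s k 0 - speed s' k 0| <= L * `|s - s'|.
  case: (split_ordP k) => j ->.
    by rewrite ord1 !speed0 subrr normr0 mulr_ge0// ltW.
  apply: le_trans (hL s s'); case: (split_ordP j) => i ->.
    by rewrite !speedQ; exact: matching_rate_dist.
  rewrite !speedD.
  by have := normr_mx_entry_le (clamped_drift md s - clamped_drift md s') i 0; rewrite !mxE.
move=> x; apply/cvgrPdist_lt => e e0; near=> y.
apply: (le_lt_trans (lip _ _)).
rewrite opprD addrACA subrr add0r -ltr_pdivlMl//.
near: y; apply: cvgr_dist_lt; [exact: cvg_id|by rewrite mulr_gt0// invr_gt0].
Unshelve. all: by end_near. Qed.

Lemma continuous_speed_along t z k : continuous (fun s => speed (stT z + (s - t)) k 0).
Proof.
have -> : (fun s => speed (stT z + (s - t)) k 0) = (fun s => speed ((stT z - t) + s) k 0).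
  by apply/funext => s; rewrite addrAC addrA.
exact: continuous_speed.
Qed.

Lemma trajectory_before t z r : r <= t -> trajectory t z r = z.
Proof.
move=> rt; apply/matrixP => k j; rewrite ord1 mxE.
suff -> : \int[lebesgue_measure]_(s in `[t, r]) speed (stT z + (s - t)) k 0 = 0.
  by rewrite addr0.
move: rt; rewrite le_eqVlt => /orP[/eqP ->|rt].
  by rewrite set_itv1 Rintegral_set1.
by rewrite set_itv_ge ?Rintegral_set0// bnd_simp -ltNge.
Qed.

Lemma Rintegral_itv_cst1 t r : t <= r -> \int[lebesgue_measure]_(s in `[t, r]) (1 : R) = r - t.
Proof.
move=> tr; rewrite Rintegral_cst// mul1r [X in fine X](lebesgue_measure_itv `[t, r])/= lte_fin.
case: ltP => [//|rt] /=; apply/eqP; rewrite eq_sym subr_eq0; apply/eqP.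
by apply: le_anti; rewrite rt tr.
Qed.

Lemma stT_trajectory t z r : t <= r -> stT (trajectory t z r) = stT z + (r - t).
Proof.
move=> tr; rewrite !stTE mxE; congr (_ + _).
by under eq_Rintegral do rewrite speed0; exact: Rintegral_itv_cst1.
Qed.

Lemma stQ_trajectory_ge t z r i : stQ z i 0 <= stQ (trajectory t z r) i 0.
Proof.
rewrite !stQE mxE lerDl; apply: Rintegral_ge0 => s _.
by rewrite speedQ matching_rate_ge0.
Qed.

Lemma trajectory_gap t z r i : stD (trajectory t z r) i 0 - stD z i 0 <=
  stQ (trajectory t z r) i 0 - stQ z i 0.
Proof.
rewrite !stQE !stDE !mxE !(addrAC _ _ (- _)) !subrr !add0r.
apply: le_Rintegral => //.
- exact/continuous_integrable_itv/continuous_speed_along.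
- exact/continuous_integrable_itv/continuous_speed_along.
- by move=> s _; rewrite speedQ speedD matching_rate_ge.
Qed.

Lemma within_continuous_trajectory T t z : 0 <= t <= T ->
  {within `[0, T], continuous (trajectory t z)}.
Proof.
move=> tT; apply: within_continuous_entries => k.
rewrite (_ : (fun r => _) = (fun r => z k 0 +
  \int[lebesgue_measure]_(s in `[t, r]) speed (stT z + (s - t)) k 0)); last first.
  by apply/funext => r; rewrite mxE.
move=> x; apply: cvgD; first exact: cvg_cst.
exact: within_continuous_Rintegral (@continuous_speed_along t z k) tT x.
Qed.

End trajectory.

(** * Existence and uniqueness under the feedback *)

Section solution.
Context (R : realType) (N : nat) (md : model R N) (d : measure_display)
  (Omega : measurableType d) (P : probability Omega R)
  (F : R -> set (set Omega)) (W : R -> Omega -> 'cV[R]_N).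
Hypotheses (hF : filtration F) (hW : brownian_motion P F W).
Variables (t : R) (z : state R N).
Hypothesis htT : t \in `[0, horizon md].

Let T := horizon md.
Let t0 : 0 <= t. Proof. by move: htT; rewrite in_itv/= => /andP[]. Qed.
Let tT : t <= T. Proof. by move: htT; rewrite in_itv/= => /andP[]. Qed.

Let B (i : 'I_N) (s : R) (w : Omega) : R := W s w i 0.

Lemma brownian_component_adapted i s : 0 <= s -> measurable_wrt (F s) (B i s).
Proof. by case: hW => aW _ _ _ s0; apply: aW; rewrite /= in_itv/= s0. Qed.

(** The rectangle with side [X] in direction [i] and the whole line in the others: the remaining
    factors have mass 1. *)
Lemma brownian_component_indep i s s' : 0 <= s -> s < s' ->
  forall A X, F s A -> measurable X ->
  P (A `&` (fun w => B i s' w - B i s w) @^-1` X) =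
  (P A * normal_prob 0%R (Num.sqrt (s' - s)) X)%E.
Proof.
move=> s0 ss' A X FA mX; case: hW => _ _ /(_ _ _ s0 ss' A FA) hB _.
pose Bs j : set R := if j == i then X else setT.
have mBs j : measurable (Bs j) by rewrite /Bs; case: ifP.
have := hB Bs mBs.
rewrite (bigD1 i)//= big1 ?mule1; last first.
  move=> j /negbTE ji; rewrite /Bs ji.
  by rewrite [LHS](probability_setT (normal_prob 0 (Num.sqrt (s' - s)))).
rewrite {2}/Bs eqxx => <-; congr (P (A `&` _)).
apply/seteqP; split => w /=; rewrite /Bs.
  by move=> Xw j; case: eqP => [->|].
by move=> /(_ i); rewrite eqxx.
Qed.

Lemma volatility_feedback (Y : state R N) : volatility md Y (feedback md Y) = 0.
Proof. exact: volatility_eq0. Qed.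

Lemma trajectory_is_solution :
  is_solution P F W (@drift R N md) (@volatility R N md) (feedback md) T t z
    (fun r _ => trajectory md t z r).
Proof.
have hD j s : s \in `[t, T] -> drift md (trajectory md t z s)
    (feedback md (trajectory md t z s)) j 0 = speed md (stT z + (s - t)) j 0.
  by rewrite in_itv/= => /andP[ts _]; rewrite drift_feedback stT_trajectory.
split.
- move=> r; rewrite /= in_itv/= => /andP[r0 _] i; apply: measurable_wrt_cst.
  by case: hF => + _ _; exact.
- by apply: aeW => w; apply: within_continuous_trajectory; rewrite t0.
- by move=> r w; rewrite in_itv/= => /andP[_ rt]; exact: trajectory_before.
- apply: aeW => w j.
  have := continuous_integrable_itv (@continuous_speed_along _ _ md t z j) t T.
  by apply: eq_integrable => // s; rewrite inE/= => sT; rewrite /= hD.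
exists (fun _ _ _ _ => 0); split.
  move=> j i; have sFt : sigma_algebra setT (F t) by case: hF => + _ _; exact.
  have := is_ito_integral_cst0 P (B i) T sFt; congr is_ito_integral.
  by apply/funext => s; apply/funext => w; rewrite volatility_feedback mxE.
apply: aeW => w r rtT j; rewrite big1// addr0 mxE; congr (_ + _).
apply: eq_Rintegral => s; rewrite inE/= in_itv/= => /andP[ts sr].
rewrite hD// in_itv/= ts (le_trans sr)//.
by move: rtT; rewrite in_itv/= => /andP[].
Qed.

(** The integrands of the Ito terms are zero, so these terms vanish almost surely and an equation
    with drift alone remains on each path. *)
Lemma solution_unique (Y : R -> Omega -> state R N) :
  is_solution P F W (@drift R N md) (@volatility R N md) (feedback md) T t z Y ->
  {ae P, forall w, forall r, r \in `[0, T] -> Y r w = trajectory md t z r}.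
Proof.
move=> [_ _ Yt _ [I [ItoI YE]]].
have I0 : {ae P, forall w, forall j i, forall r, r \in `[t, T] -> I j i r w = 0}.
  apply: filter_forall => j; apply: filter_forall => i.
  apply: (ito_integral0 hF (B := B i)) => //.
  - by move=> s; exact: brownian_component_adapted.
  - by move=> s s'; exact: brownian_component_indep.
  have := ItoI j i; congr is_ito_integral.
  by apply/funext => s; apply/funext => w; rewrite volatility_feedback mxE.
apply: filterS2 I0 YE => w I0 YE r; rewrite in_itv/= => /andP[r0 rT].
have [rt|/ltW tr] := leP r t.
  by rewrite trajectory_before// Yt// in_itv/= r0.
have YE' s j : s \in `[t, T] -> Y s w j 0 = z j 0 +
    \int[lebesgue_measure]_(s in `[t, s]) speed md (stT (Y s w)) j 0.
  move=> sT; rewrite (YE s sT j) big1 ?addr0; last by move=> i _; exact: I0.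
  by congr (_ + _); apply: eq_Rintegral => s' _; rewrite drift_feedback.
(* The time coordinate comes first: the drift depends on nothing else, so it fixes all the other
   coordinates. *)
have YT s : s \in `[t, T] -> stT (Y s w) = stT z + (s - t).
  move=> sT; rewrite !stTE YE'//; congr (_ + _).
  under eq_Rintegral do rewrite speed0.
  by rewrite Rintegral_itv_cst1//; move: sT; rewrite in_itv => /andP[].
apply/matrixP => j k; rewrite ord1 YE' ?in_itv/= ?tr// mxE; congr (_ + _).
apply: eq_Rintegral => s; rewrite inE/= in_itv/= => /andP[ts sr].
by rewrite YT// in_itv/= ts (le_trans sr).
Qed.

Lemma the_solution_trajectory_stays_in (A : set (state R N)) :
  (forall r, A (trajectory md t z r)) ->
  the_solution_stays_in P F W (@drift R N md) (@volatility R N md)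
    (feedback md) T t z A.
Proof.
move=> Atraj; exists (fun r _ => trajectory md t z r); split.
- exact: trajectory_is_solution.
- by apply: aeW => w r _.
- by move=> Y hY _; exact: solution_unique.
Qed.

End solution.

(** * Controls pointing inwards *)

Lemma drift_control_inward (R : realType) (N M : nat) (nw : network R N M)
    (md : model R N) (x : state R N) : (0 < N)%N ->
  budget_sup md < budget md ->
  exists ux r eta,
    [/\ Uset md ux, 0 < r, 0 < eta,
        forall z, (eball x eta `&` constraint_set nw) z -> volatility md z ux = 0 &
        forall z t, (eball x eta `&` constraint_set nw) z -> 0 < t < r ->
          eball (z + t *: drift md z ux) (r * t) `<=` (constraint_set nw)°].
Proof.
move=> hN hb; have [L L0 hL] := clamped_drift_lipschitz md.
pose h : R := \sum_i unit_cost md i 0.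
have h0 : 0 < h.
  rewrite /h (bigD1 (Ordinal hN))//= ltr_wpDr ?unit_cost_gt0//.
  by apply: sumr_ge0 => i _; rewrite ltW// unit_cost_gt0.
(* Raising every rate by [e] costs [h * e], which is exactly the slack in the budget. *)
pose e := (budget md - budget_sup md) / h.
have e0 : 0 < e by rewrite divr_gt0// subr_gt0.
pose mu : 'cV[R]_N := matching_rate md (stT x) + const_mx e.
(* In the ball of radius [e / (4 * L)] the demand drift differs from its value at [x] by at most
   [e / 4]; the radius [e / 4 * t] of the target ball is an error of the same size. *)
exists (mu, const_mx 1), (e / 4), (e / (4 * L)); split.
- split=> [i||i] /=.
  + by rewrite !mxE addr_ge0 ?(ltW e0)// le_max lexx orbT.
  + rewrite (eq_bigr (fun i => unit_cost md i 0 * matching_rate md (stT x) i 0 +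
        unit_cost md i 0 * e)); last by move=> i _; rewrite -mulrDr !mxE.
    rewrite big_split /= -mulr_suml -/h (_ : h * e = budget md - budget_sup md).
      by have := matching_rate_cost_le md (stT x); lra.
    by rewrite /e mulrC divfK// gt_eqF.
  + by rewrite mxE lexx ler01.
- by rewrite divr_gt0.
- by rewrite divr_gt0// mulr_gt0.
- by move=> z _; exact: volatility_eq0.
move=> z t [/= xz Cz] /andP[t0 tr] y /= zy.
have dT : `|stT z - stT x| < e / (4 * L).
  apply: le_lt_trans xz; rewrite !stTE.
  by have := enorm_entry_le (z - x) (lshift (N + N) 0); rewrite !mxE.
have dp i : clamped_drift md (stT z) i 0 <= clamped_drift md (stT x) i 0 + e / 4.
  have := normr_mx_entry_le (clamped_drift md (stT z) - clamped_drift md (stT x)) i 0.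
  have LdT : L * `|stT z - stT x| <= e / 4.
    by move/ltW: dT; rewrite -(ler_pM2l L0) => /le_trans; apply;
      rewrite le_eqVlt; apply/orP; left; apply/eqP; field; rewrite gt_eqF.
  have := hL (stT z) (stT x).
  rewrite !mxE => h1 h2.
  have := ler_norm (clamped_drift md (stT z) i 0 - clamped_drift md (stT x) i 0).
  by lra.
have dy k : `|y k 0 - (z k 0 + t * drift md z (mu, const_mx 1) k 0)| < e / 4 * t.
  apply: le_lt_trans zy.
  by have := enorm_entry_le (y - (z + t *: drift md z (mu, const_mx 1))) k; rewrite !mxE.
have dQ i : `|stQ y i 0 - (stQ z i 0 + t * (matching_rate md (stT x) i 0 + e))| < e / 4 * t.
  have := dy (rshift 1 (lshift N i)).
  by rewrite /drift col_mxEd col_mxEu [mu i 0]mxE [const_mx e i 0]mxE !stQE.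
have dD i : `|stD y i 0 - (stD z i 0 + t * clamped_drift md (stT z) i 0)| < e / 4 * t.
  by have := dy (rshift 1 (rshift N i)); rewrite /drift !col_mxEd !stDE.
have te : 0 < t * e by rewrite mulr_gt0.
have tm i : 0 <= t * matching_rate md (stT x) i 0.
  by rewrite mulr_ge0 ?matching_rate_ge0// ltW.
have tp i : t * clamped_drift md (stT z) i 0 <= t * matching_rate md (stT x) i 0 + t * e / 4.
  rewrite -mulrA -mulrDr ler_wpM2l ?(ltW t0)//.
  by have := dp i; have := matching_rate_ge md (stT x) i; lra.
(* The gain [t * e] in [Q - D] loses at most [t * e / 4] three times: to the variation of the demand
   drift and to the displacements of [Q] and of [D] within the target ball. A margin of [t * e / 4]
   is left. *)
apply: (@constraint_set_interior _ _ _ nw hN z y (t * e / 4)) => // [|i|i].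
- by rewrite divr_gt0.
- have := dQ i; have := tm i; rewrite ltr_norml => ? /andP[? ?]; lra.
- have := dQ i; have := dD i; have := tp i.
  by rewrite !ltr_norml => ? /andP[? ?] /andP[? ?]; lra.
Qed.

Theorem proposition5p2 (R : realType) (N M : nat) (hN : (0 < N)%N)
    (hM : (0 < M)%N) (nw : network R N M) (md : model R N)
    (d : measure_display) (Omega : measurableType d) (P : probability Omega R)
    (F : R -> set (set Omega)) (W : R -> Omega -> 'cV[R]_N)
    (hF : filtration F) (hW : brownian_motion P F W)
    (hbudget :
      sup [set \sum_i unit_cost md i 0 * Num.max (demand_drift md s i 0) 0
          | s in `[0, horizon md]] < budget md) :
  let T := horizon md in
  let C := constraint_set nw in
  let b := @drift R N md in
  let sigma := @volatility R N md in
  (exists utilde uhat : state R N -> control R N,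
    [/\ (forall z, C° z -> Uset md (utilde z)) /\
        [lipschitz utilde z | z in C°],
        (forall z, C z -> Uset md (uhat z)) /\
        [lipschitz uhat z | z in C],
        forall t z, t \in `[0, T] -> C° z ->
          the_solution_stays_in P F W b sigma utilde T t z C° &
        forall t z, t \in `[0, T] -> C z ->
          the_solution_stays_in P F W b sigma uhat T t z C]) /\
  (forall x, boundary C x ->
    exists ux r eta,
      [/\ Uset md ux, 0 < r, 0 < eta,
          forall z, (eball x eta `&` C) z -> sigma z ux = 0 &
          forall z t, (eball x eta `&` C) z -> 0 < t < r ->
            eball (z + t *: b z ux) (r * t) `<=` C°]).
Proof.
move=> T C b sigma; split; last by move=> x _; exact: drift_control_inward.
exists (feedback md), (feedback md); split.
- split=> [z _|]; last exact: feedback_lipschitz.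
  exact: feedback_Uset (ltW hbudget).
- split=> [z _|]; last exact: feedback_lipschitz.
  exact: feedback_Uset (ltW hbudget).
- move=> t z htT Cz; apply: the_solution_trajectory_stays_in => // r.
  apply: (interior_constraint_set_mono hN Cz) => i.
    exact: stQ_trajectory_ge.
  exact: trajectory_gap.
- move=> t z htT Cz; apply: the_solution_trajectory_stays_in => // r.
  apply: (constraint_set_mono hN Cz) => i.
    exact: stQ_trajectory_ge.
  exact: trajectory_gap.
Qed.
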